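(* The Bessel--Fischer product on $\mathcal P(\mathbb C^{m|2n})$ is superhermitian, i.e. $$\langle p,q\rangle_{\mathcal B}=(-1)^{|p||q|}\,\overline{\langle q,p\rangle_{\mathcal B}}$$ for all (parity-homogeneous) $p,q\in\mathcal P(\mathbb C^{m|2n})$.
   Context: Fix integers $m\ge 2$, $n\ge 0$ and put $M=m-2n$. Set $|i|=0$ for $0\le i\le m-1$ and $|i|=1$ for $m\le i\le m+2n-1$. $\mathcal P(\mathbb C^{m|2n})=\mathbb C[z_0,\dots,z_{m-1}]\otimes\Lambda(z_m,\dots,z_{m+2n-1})$ is the superalgebra of complex superpolynomials, with $z_iz_j=(-1)^{|i||j|}z_jz_i$; $|p|\in\{0,1\}$ is the parity of $p$, and formulas involving $|p|$ are stated for parity-homogeneous elements and extended linearly. $\beta=(\beta_{ij})_{i,j=0}^{m+2n-1}$ is the matrix with $\beta_{00}=-1$, $\beta_{ii}=1$ for $1\le i\le m-1$, $\beta_{m+i,m+n+i}=-1$ and $\beta_{m+n+i,m+i}=1$ for $0\le i<n$, all other entries $0$; $(\beta^{ij})$ is its inverse matrix. $\partial^i$ is the (left) superderivation of parity $|i|$ with $\partial^i(z_j)=\delta_{ij}$, and $\partial_j=\sum_i\beta_{ji}\partial^i$. Put $\mathbb E=\sum_{i,j}\beta^{ij}z_i\partial_j$ and $\Delta=\sum_{i,j}\beta^{ij}\partial_i\partial_j$. Bessel operators: $\mathcal B(z_k)=(M-2+2\mathbb E)\partial_k-z_k\Delta$; modified Bessel operators: $\widetilde{\mathcal B}(z_0)=-\mathcal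 B(z_0)$ and $\widetilde{\mathcal B}(z_k)=\mathcal B(z_k)$ for $k\ge1$. They supercommute, so for a superpolynomial $p$ the operator $p(\widetilde{\mathcal B})$, obtained by replacing each $z_i$ by $\widetilde{\mathcal B}(z_i)$ (keeping the order of factors), is well defined. The Bessel--Fischer product is $\langle p,q\rangle_{\mathcal B}=p(\widetilde{\mathcal B})\,\bar q(z)\big|_{z=0}$, where $\bar q$ is obtained from $q$ by complex conjugating its coefficients. *)

(* Defs.v *)
From HB Require Import structures.
From mathcomp Require Import all_boot all_order all_algebra.
From mathcomp Require Import reals complex mpoly ring.

Set Implicit Arguments.
Unset Strict Implicit.
Unset Printing Implicit Defensive.

Import GRing.Theory Num.Theory.

Local Open Scope ring_scope.

(* Number of inversions made by listing A before B. *)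
Definition crossings (k : nat) (A B : {set 'I_k}) : nat :=
  (\sum_(a in A) \sum_(b in B) (b < a))%N.

(* P(K^{m|2n}) = K[z_0, .., z_(m-1)] (x) Lambda(z_m, .., z_(m+2n-1)), as a free
   module over the even polynomials: p S is the coefficient, written on the
   left, of the product of the z_(m+j), j in S, taken in increasing order. *)
Definition superpoly (K : fieldType) (m n : nat) : Type :=
  {ffun {set 'I_(n + n)} -> {mpoly K[m]}}.

Section SuperPolynomials.

Variables (K : fieldType) (m n : nat).
Local Notation P := (superpoly K m n).
Local Notation idx := 'I_(m + (n + n)).

HB.instance Definition _ :=
  GRing.Lmodule.copy P {ffun {set 'I_(n + n)} -> {mpoly K[m]}}.

Definition sp_one : P := [ffun S : {set 'I_(n + n)} => (S == set0)%:R].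

Definition sp_mul (p q : P) : P :=
  [ffun S : {set 'I_(n + n)} => \sum_(T : {set 'I_(n + n)} | T \subset S)
     (-1) ^+ crossings T (S :\: T) * (p T * q (S :\: T))].

Lemma crossingsUl (A B D : {set 'I_(n + n)}) : [disjoint A & B] ->
  crossings (A :|: B) D = (crossings A D + crossings B D)%N.
Proof. move=> dAB; rewrite /crossings -bigU //; by apply: eq_bigl => x; rewrite !inE. Qed.

Lemma crossingsUr (A B D : {set 'I_(n + n)}) : [disjoint A & B] ->
  crossings D (A :|: B) = (crossings D A + crossings D B)%N.
Proof.
move=> dAB; rewrite /crossings -big_split; apply: eq_bigr => d _.
rewrite -bigU //; by apply: eq_bigl => x; rewrite !inE.
Qed.

Lemma crossings0l (A : {set 'I_(n + n)}) : crossings set0 A = 0%N.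
Proof. by rewrite /crossings big_set0. Qed.

Lemma crossings0r (A : {set 'I_(n + n)}) : crossings A set0 = 0%N.
Proof. by rewrite /crossings big1 // => a _; rewrite big_set0. Qed.

Lemma sp_mulA : associative sp_mul.
Proof.
move=> p q r; apply/ffunP => S; rewrite !ffunE.
under eq_bigr => T _ do rewrite ffunE 2!big_distrr /=.
under [RHS]eq_bigr => T _ do rewrite ffunE big_distrl big_distrr /=.
rewrite [RHS](exchange_big_dep (fun U : {set 'I_(n + n)} => U \subset S)) /=;
  last by move=> T U sTS sUT; apply: subset_trans sUT sTS.
apply: eq_bigr => U sUS.
rewrite [RHS](reindex_onto (fun V => U :|: V) (fun T => T :\: U)) /=; last first.
  by move=> T /andP[_ /setIidPr UT]; rewrite setDE setUIr setUCr setIT; 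
     apply/setUidPr/setIidPr.
apply: eq_big => [V|V sV].
  rewrite subsetD subUset sUS subsetUl /= andbT; congr (_ && _).
  by rewrite setDUl setDv set0U; apply/setDidPl/eqP.
have [sVS dVU] : V \subset S /\ [disjoint V & U].
  by move: sV; rewrite subsetD => /andP.
have dUV : [disjoint U & V] by rewrite disjoint_sym.
have -> : (U :|: V) :\: U = V by rewrite setDUl setDv set0U; apply/setDidPl.
have eW : S :\: U :\: V = S :\: (U :|: V) by rewrite setDDl.
have eSU : S :\: U = V :|: (S :\: (U :|: V)).
  apply/setP=> x; rewrite !inE; have := subsetP sVS x; have := disjointFr dVU (x:=x).
  by case: (x \in V) => [->//|_ _] /=; [move=> ->|rewrite orbF].
rewrite eW {1}eSU crossingsUr; last first.
  by rewrite disjoint_sym disjoints_subset; apply/subsetP=> x;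
     rewrite !inE negb_or => /andP[/andP[]].
by rewrite crossingsUl // !exprD; ring.
Qed.

Lemma sp_mul1l : left_id sp_one sp_mul.
Proof.
move=> p; apply/ffunP => S; rewrite ffunE (bigD1 set0) ?sub0set //= big1.
  by rewrite ffunE eqxx crossings0l setD0 expr0 !mul1r addr0.
by move=> T /andP[_ /negPf T0]; rewrite ffunE T0 mul0r mulr0.
Qed.

Lemma sp_mul1r : right_id sp_one sp_mul.
Proof.
move=> p; apply/ffunP => S; rewrite ffunE (bigD1 S) //= big1.
  by rewrite ffunE setDv eqxx crossings0r expr0 mul1r mulr1 addr0.
move=> T /andP[sTS nTS]; rewrite ffunE setD_eq0.
case: (boolP (S \subset T)) => sST; last by rewrite !mulr0.
by rewrite eqEsubset sTS sST in nTS.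
Qed.

Lemma sp_mulDl : left_distributive sp_mul +%R.
Proof.
move=> p q r; apply/ffunP => S; rewrite !ffunE -big_split; apply: eq_bigr => T _.
by rewrite ffunE /= mulrDl mulrDr.
Qed.

Lemma sp_mulDr : right_distributive sp_mul +%R.
Proof.
move=> p q r; apply/ffunP => S; rewrite !ffunE -big_split; apply: eq_bigr => T _.
by rewrite ffunE /= !mulrDr.
Qed.

Lemma sp_one_neq0 : sp_one != 0.
Proof.
apply/eqP => /ffunP/(_ set0); rewrite !ffunE eqxx => /eqP.
by rewrite oner_eq0.
Qed.

HB.instance Definition _ := GRing.Zmodule_isNzRing.Build P
  sp_mulA sp_mul1l sp_mul1r sp_mulDl sp_mulDr sp_one_neq0.


Lemma sp_scaleAl (a : K) (p q : P) : a *: (p * q) = (a *: p) * q.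
Proof.
apply/ffunP => S; rewrite !ffunE scaler_sumr; apply: eq_bigr => T _.
by rewrite ffunE /= scalerAr scalerAl.
Qed.

HB.instance Definition _ := GRing.Lmodule_isLalgebra.Build K P sp_scaleAl.

Lemma sp_scaleAr (a : K) (p q : P) : a *: (p * q) = p * (a *: q).
Proof.
apply/ffunP => S; rewrite !ffunE scaler_sumr; apply: eq_bigr => T _.
by rewrite ffunE /= !scalerAr.
Qed.

HB.instance Definition _ := GRing.Lalgebra_isAlgebra.Build K P sp_scaleAr.

Lemma sp_mulE (p q : P) (S : {set 'I_(n + n)}) : (p * q) S =
  \sum_(T : {set 'I_(n + n)} | T \subset S)
     (-1) ^+ crossings T (S :\: T) * (p T * q (S :\: T)).
Proof. exact: ffunE. Qed.

Lemma sp_addE (p q : P) (S : {set 'I_(n + n)}) : (p + q) S = p S + q S.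
Proof. exact: ffunE. Qed.

Lemma sp_scaleE (c : K) (p : P) (S : {set 'I_(n + n)}) : (c *: p) S = c *: p S.
Proof. exact: ffunE. Qed.

(* The indices of z_0, .., z_(m+2n-1) live in 'I_(m + (n + n)): lshift (n + n) i
   is the even index i and rshift m j is the odd index m + j. *)
Definition parity (k : idx) : bool := (m <= k)%N.

(* 0 is homogeneous of both parities. *)
Definition homogeneous (b : bool) (p : P) : bool :=
  [forall S : {set 'I_(n + n)}, (p S != 0) ==> (odd #|S| == b)].

Definition z (k : idx) : P :=
  match split k with
  | inl i => [ffun S : {set 'I_(n + n)} => if S == set0 then 'X_i else 0]
  | inr j => [ffun S : {set 'I_(n + n)} => (S == [set j])%:R]
  end.

(* The upper-index derivation \partial^k; an odd one acts from the left, so it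
   first moves z_(m+j) to the front of the odd monomial. It is characterised by
   dup_z and dup_superder below. *)
Definition dup (k : idx) (p : P) : P :=
  match split k with
  | inl i => [ffun S : {set 'I_(n + n)} => mderiv i (p S)]
  | inr j => [ffun S : {set 'I_(n + n)} =>
      if j \in S then 0
      else (-1) ^+ crossings [set j] S * p (j |: S)]
  end.


Lemma z_lshiftE (i : 'I_m) (S : {set 'I_(n + n)}) :
  z (lshift (n + n) i) S = if S == set0 then 'X_i else 0.
Proof. by rewrite /z (unsplitK (inl i)) ffunE. Qed.

Lemma z_rshiftE (j : 'I_(n + n)) (S : {set 'I_(n + n)}) :
  z (rshift m j) S = (S == [set j])%:R.
Proof. by rewrite /z (unsplitK (inr j)) ffunE. Qed.

Lemma parity_lshift (i : 'I_m) : parity (lshift (n + n) i) = false.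
Proof. by apply/negbTE; rewrite /parity -ltnNge /=. Qed.

Lemma parity_rshift (j : 'I_(n + n)) : parity (rshift m j) = true.
Proof. by rewrite /parity /= leq_addr. Qed.

Lemma z_even (i : 'I_m) (p : P) (S : {set 'I_(n + n)}) :
  (z (lshift (n + n) i) * p) S = 'X_i * p S.
Proof.
rewrite ffunE (bigD1 set0) ?sub0set //= big1.
  by rewrite z_lshiftE eqxx crossings0l setD0 expr0 mul1r addr0.
by move=> T /andP[_ /negPf T0]; rewrite z_lshiftE T0 mul0r mulr0.
Qed.

Lemma z_odd (j : 'I_(n + n)) (p : P) (S : {set 'I_(n + n)}) :
  (z (rshift m j) * p) S =
  if j \in S then (-1) ^+ crossings [set j] (S :\ j) * p (S :\ j) else 0.
Proof.
rewrite ffunE; case: ifPn => jS.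
  rewrite (bigD1 [set j]) ?sub1set //= big1.
    by rewrite z_rshiftE eqxx mul1r addr0.
  by move=> T /andP[_ /negPf T0]; rewrite z_rshiftE T0 mul0r mulr0.
apply: big1 => T sTS; rewrite z_rshiftE; case: eqP => [eT|]; rewrite ?mul0r ?mulr0 //.
by rewrite eT sub1set (negPf jS) in sTS.
Qed.

Lemma crossings_swap (j : 'I_(n + n)) (S : {set 'I_(n + n)}) : j \notin S ->
  (crossings [set j] S + crossings S [set j])%N = #|S|.
Proof.
move=> jS; rewrite /crossings big_set1 -big_split /= -sum1_card.
apply: eq_bigr => a aS; rewrite big_set1.
by case: ltngtP => // /val_inj eaj; rewrite -eaj aS in jS.
Qed.

Lemma sum_subset1U (V : nmodType) (j : 'I_(n + n)) (S : {set 'I_(n + n)})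
    (F : {set 'I_(n + n)} -> V) : j \notin S ->
  \sum_(T : {set 'I_(n + n)} | T \subset j |: S) F T =
  \sum_(T : {set 'I_(n + n)} | T \subset S) F T
  + \sum_(T : {set 'I_(n + n)} | T \subset S) F (j |: T).
Proof.
move=> jS; rewrite (bigID (fun T : {set 'I_(n + n)} => j \in T)) /= addrC.
congr (_ + _).
  apply: eq_bigl => T; apply/andP/idP => [[sT jT]|sT].
    apply/subsetP => x xT; move/subsetP: sT => /(_ x xT); rewrite !inE.
    by case/orP => // /eqP ex; rewrite -ex xT in jT.
  split; first exact: subset_trans sT (subsetUr _ _).
  by apply: contra jS; apply: (subsetP sT).
rewrite (reindex_onto (fun T => j |: T) (fun T => T :\ j)) /=; last first.
  by move=> T /andP[_ jT]; rewrite setD1K.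
apply: eq_bigl => T; rewrite setU11 andbT.
apply/andP/idP => [[sT /eqP eT]|sT].
  by rewrite -eT; apply/subsetP => x; rewrite !inE => /andP[xj];
     move/subsetP: sT => /(_ x); rewrite !inE (negPf xj).
split; first exact: setUS.
by apply/eqP/setU1K; apply: contra jS; apply: (subsetP sT).
Qed.


Lemma z_supercomm (i j : idx) :
  z i * z j = (-1) ^+ (parity i * parity j)%N * (z j * z i).
Proof.
have ev (k l : 'I_m) :
    z (lshift (n + n) k) * z (lshift (n + n) l)
    = z (lshift (n + n) l) * z (lshift (n + n) k).
  apply/ffunP => S; rewrite !z_even !z_lshiftE.
  by case: ifP => _; rewrite ?mulr0 // mulrC.
have eo (k : 'I_m) (l : 'I_(n + n)) :
    z (lshift (n + n) k) * z (rshift m l) = z (rshift m l) * z (lshift (n + n) k).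
  apply/ffunP => S; rewrite z_even z_odd z_rshiftE z_lshiftE.
  case: ifPn => [lS|]; last first.
    by case: eqP => [->|_]; rewrite ?inE ?eqxx ?mulr0.
  rewrite setD_eq0 subset1; case: eqP => [->|_] /=.
    by rewrite setDv crossings0r expr0 mul1r mulr1.
  by case: eqP lS => [->|_]; rewrite ?inE // !mulr0.
case: (split_ordP i) => k ->; case: (split_ordP j) => l ->;
  rewrite ?parity_lshift ?parity_rshift ?muln0 ?mul0n ?expr0 ?mul1r.
- exact: ev.
- exact: eo.
- by rewrite eo.
rewrite muln1 expr1 mulN1r; apply/ffunP => S.
rewrite [RHS]ffunE !z_odd !z_rshiftE.
have [<-|kl] := eqVneq k l.
  case: ifP => kS; rewrite ?oppr0 //.
  suff /negPf-> : S :\ k != [set k] by rewrite mulr0 oppr0.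
  by apply/eqP => /setP/(_ k); rewrite !inE eqxx.
have e2 (u v : 'I_(n + n)) : u != v ->
    (if u \in S then (-1) ^+ crossings [set u] (S :\ u) * (S :\ u == [set v])%:R
     else 0) = (S == [set u; v])%:R * (-1) ^+ (v < u)%N :> {mpoly K[m]}.
  move=> uv; have uE : [set u; v] :\ u = [set v] by rewrite setU1K // inE.
  case: (eqVneq S [set u; v]) => [->|nS].
    by rewrite uE !inE !eqxx /crossings !big_set1 mulr1 mul1r.
  rewrite mul0r; case: ifP => // uS; case: eqP => [eS|_]; last by rewrite mulr0.
  by rewrite -(setD1K uS) eS eqxx in nS.
have lk : l != k by rewrite eq_sym.
rewrite (e2 _ _ kl) (e2 _ _ lk) [[set l; k]]setUC -mulrN; congr (_ * _).
case: ltngtP => [_|_|ekl]; rewrite ?expr0 ?expr1 ?opprK //.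
by rewrite (val_inj ekl) eqxx in kl.
Qed.

Lemma dup_lshiftE (i : 'I_m) (p : P) (S : {set 'I_(n + n)}) :
  dup (lshift (n + n) i) p S = mderiv i (p S).
Proof. by rewrite /dup (unsplitK (inl i)) ffunE. Qed.

Lemma dup_rshiftE (j : 'I_(n + n)) (p : P) (S : {set 'I_(n + n)}) :
  dup (rshift m j) p S =
  if j \in S then 0 else (-1) ^+ crossings [set j] S * p (j |: S).
Proof. by rewrite /dup (unsplitK (inr j)) ffunE. Qed.

Lemma dup_is_linear (k : idx) : linear (dup k).
Proof.
move=> c p q; apply/ffunP => S.
rewrite sp_addE sp_scaleE.
case: (split_ordP k) => [i|j] ->; first by rewrite !dup_lshiftE !ffunE linearP.
rewrite !dup_rshiftE !ffunE; case: ifP => _; first by rewrite scaler0 addr0.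
by rewrite mulrDr scalerAr.
Qed.

HB.instance Definition _ (k : idx) :=
  GRing.isLinear.Build K P P *:%R (dup k) (dup_is_linear k).

Lemma dup_z (i j : idx) : dup i (z j) = (i == j)%:R.
Proof.
have oneE (b : bool) S : (b%:R : P) S = ((S == set0) && b)%:R.
  by case: b; rewrite ?andbT ?andbF ffunE.
apply/ffunP => S; rewrite oneE.
case: (split_ordP i) => k ->; case: (split_ordP j) => l ->.
- rewrite dup_lshiftE z_lshiftE eq_lshift; case: eqP => _ /=; rewrite ?mderiv0 //.
  rewrite mderivX mnm1E eq_sym; case: eqP => [->|_]; last by rewrite scale0r.
  by rewrite -{1}[U_(l)%MM]addm0 addmC addmK mpolyX0 scale1r.
- rewrite dup_lshiftE z_rshiftE eq_lrshift andbF.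
  by rewrite -mpolyC_nat mderivC.
- rewrite dup_rshiftE z_lshiftE eq_rlshift andbF; case: ifP => // _.
  by case: eqP => [/setP/(_ k)|_]; rewrite ?mulr0 // !inE eqxx.
rewrite dup_rshiftE z_rshiftE eq_rshift.
have [->|nS] := eqVneq S set0.
  rewrite inE setU0 crossings0r expr0 mul1r /=.
  by rewrite (inj_eq set1_inj).
case: ifPn => //= kS; case: eqP => [eS|_]; last by rewrite mulr0.
case/set0Pn: nS => x xS; have /setP/(_ x) := eS; have /setP/(_ k) := eS.
rewrite !inE eqxx xS orbT /= => /esym/eqP <- /esym/eqP ex.
by rewrite -ex xS in kS.
Qed.

Lemma homogeneousP (b : bool) (p : P) :
  reflect (forall S : {set 'I_(n + n)}, p S != 0 -> odd #|S| = b)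
          (homogeneous b p).
Proof.
apply: (iffP forallP) => [hp S nz|hp S]; first by have := hp S; rewrite nz => /eqP.
by apply/implyP => /hp ->.
Qed.

Lemma z_homogeneous (k : idx) : homogeneous (parity k) (z k).
Proof.
apply/homogeneousP => S; case: (split_ordP k) => [i|j] ->.
  rewrite z_lshiftE parity_lshift; case: (eqVneq S set0) => [-> _|_]; rewrite ?eqxx //.
  by rewrite cards0.
rewrite z_rshiftE parity_rshift; case: (eqVneq S [set j]) => [-> _|_]; rewrite ?eqxx //.
by rewrite cards1.
Qed.

Lemma dup_homogeneous (k : idx) (b : bool) (p : P) :
  homogeneous b p -> homogeneous (parity k (+) b) (dup k p).
Proof.
move=> /homogeneousP hp; apply/homogeneousP => S.
case: (split_ordP k) => [i|j] ->.
  rewrite dup_lshiftE parity_lshift addFb => nz; apply: hp.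
  by apply: contraNneq nz => ->; rewrite mderiv0.
rewrite dup_rshiftE parity_rshift; case: ifPn => [|jS]; first by rewrite eqxx.
move=> nz; have nz' : p (j |: S) != 0.
  by apply: contraNneq nz => ->; rewrite mulr0.
by rewrite -(hp _ nz') cardsU1 jS /= negbK.
Qed.

Lemma dup_superder (k : idx) (b : bool) (p q : P) : homogeneous b p ->
  dup k (p * q) = dup k p * q + (-1) ^+ (parity k * b)%N *: (p * dup k q).
Proof.
move=> /homogeneousP hp; apply/ffunP => S.
rewrite sp_addE sp_scaleE.
case: (split_ordP k) => [i|j] ->.
  rewrite parity_lshift mul0n expr0 scale1r dup_lshiftE !sp_mulE raddf_sum -big_split.
  apply: eq_bigr => T _; rewrite !dup_lshiftE -signr_odd /=.
  by case: odd; rewrite ?expr0 ?expr1 ?mul1r ?mulN1r ?mderivN mderivM ?opprD.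
have sgn0 (T : {set 'I_(n + n)}) (c : {mpoly K[m]}) : j \notin T ->
    (-1) ^+ b *: (p T * c)
    = (-1) ^+ (crossings [set j] T + crossings T [set j])%N * (p T * c).
  move=> jT; rewrite crossings_swap // -[in RHS]signr_odd.
  have [->|nz] := eqVneq (p T) 0; first by rewrite mul0r scaler0 mulr0.
  rewrite (hp _ nz); case: (b); rewrite ?expr0 ?expr1 ?scale1r ?scaleN1r //.
    by rewrite mulN1r.
  by rewrite mul1r.
have sgn1 (T : {set 'I_(n + n)}) (c : {mpoly K[m]}) : j \notin T ->
    (-1) ^+ b *: (p (j |: T) * c)
    = - (-1) ^+ (crossings [set j] T + crossings T [set j])%N * (p (j |: T) * c).
  move=> jT; rewrite crossings_swap // -[in RHS]signr_odd.
  have [->|nz] := eqVneq (p (j |: T)) 0; first by rewrite mul0r scaler0 mulr0.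
  rewrite -(hp _ nz) cardsU1 jT /=.
  by case: odd; rewrite ?expr0 ?expr1 ?scale1r ?scaleN1r ?opprK ?mul1r ?mulN1r.
rewrite parity_rshift mul1n dup_rshiftE.
have dj (A : {set 'I_(n + n)}) : j \notin A -> [disjoint [set j] & A].
  by move=> jA; rewrite disjoints1.
case: ifPn => jS.
  have [S0 jS0 eS] : exists2 S0 : {set 'I_(n + n)}, j \notin S0 & j |: S0 = S.
    by exists (S :\ j); rewrite ?setD1K // !inE eqxx.
  rewrite -eS !sp_mulE !sum_subset1U // scalerDr.
  rewrite [X in _ + X + _]big1 => [|T sT]; last first.
    by rewrite dup_rshiftE setU11 mul0r mulr0.
  rewrite [X in _ + (_ *: X + _)]big1 => [|T sT]; last first.
    have jT : j \notin T by apply: contra jS0; apply: (subsetP sT).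
    by rewrite dup_rshiftE !inE jT eqxx /= !mulr0.
  rewrite addr0 scaler0 add0r scaler_sumr -big_split /=; apply/esym/big1 => T sT.
  have jT : j \notin T by apply: contra jS0; apply: (subsetP sT).
  have -> : (j |: S0) :\: (j |: T) = S0 :\: T.
    apply/setP => x; rewrite !inE; case: (eqVneq x j) => [->|_] //=.
    by rewrite (negPf jS0) andbF.
  have jW : j \notin S0 :\: T by rewrite in_setD (negPf jS0) andbF.
  have -> : (j |: S0) :\: T = j |: (S0 :\: T).
    apply/setP => x; rewrite !inE; case: (eqVneq x j) => [->|_] //=.
    by rewrite jT.
  move: (S0 :\: T) jW => W jW.
  have ww : (-1) ^+ crossings [set j] W * (-1) ^+ crossings [set j] W = 1
      :> {mpoly K[m]} by rewrite -expr2 sqrr_sign.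
  rewrite !dup_rshiftE (negPf jT) (negPf jW).
  rewrite [(-1) ^+ crossings (j |: T) W * _]mulrCA sgn1 //.
  rewrite crossingsUl ?dj // crossingsUr ?dj // !exprD.
  move: ww; move: ((-1) ^+ crossings [set j] W) => w ww.
  transitivity ((-1) ^+ crossings T W * (-1) ^+ crossings T [set j]
    * (-1) ^+ crossings [set j] T * p (j |: T) * q (j |: W) * (1 - w * w)).
    by ring.
  by rewrite ww subrr mulr0.
have spl (T : {set 'I_(n + n)}) : T \subset S -> j \notin T.
  by move=> sT; apply: contra jS; apply: (subsetP sT).
rewrite sp_mulE sum_subset1U // mulrDr addrC !sp_mulE scaler_sumr !mulr_sumr.
congr (_ + _); apply: eq_bigr => T sT; have jT := spl T sT;
  have jW : j \notin S :\: T by rewrite in_setD (negPf jS) andbF.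
- have -> : (j |: S) :\: (j |: T) = S :\: T.
    apply/setP => x; rewrite !inE; case: (eqVneq x j) => [->|_] //=.
    by rewrite (negPf jS) andbF.
  have cS : crossings [set j] S
      = (crossings [set j] T + crossings [set j] (S :\: T))%N.
    rewrite -crossingsUr -?setDE ?disjoints_subset; last first.
      by apply/subsetP => x; rewrite !inE => ->.
    by rewrite -[in LHS](setID S T) (setIidPr sT).
  have ww : (-1) ^+ crossings [set j] (S :\: T)
      * (-1) ^+ crossings [set j] (S :\: T) = 1 :> {mpoly K[m]}.
    by rewrite -expr2 sqrr_sign.
  rewrite dup_rshiftE (negPf jT) crossingsUl ?dj // cS !exprD.
  move: ww; move: ((-1) ^+ crossings [set j] (S :\: T)) => w ww.
  transitivity ((w * w) * ((-1) ^+ crossings [set j] T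
    * (-1) ^+ crossings T (S :\: T) * p (j |: T) * q (S :\: T))); first by ring.
  by rewrite ww; ring.
have -> : (j |: S) :\: T = j |: (S :\: T).
  apply/setP => x; rewrite !inE; case: (eqVneq x j) => [->|_] //=.
  by rewrite jT.
have cS : crossings [set j] S
    = (crossings [set j] T + crossings [set j] (S :\: T))%N.
  rewrite -crossingsUr -?setDE ?disjoints_subset; last first.
    by apply/subsetP => x; rewrite !inE => ->.
  by rewrite -[in LHS](setID S T) (setIidPr sT).
rewrite dup_rshiftE (negPf jW) [(-1) ^+ crossings T (S :\: T) * _]mulrCA sgn0 //.
by rewrite crossingsUr ?dj // cS !exprD; ring.
Qed.

(* The factors of the basis monomial z^a \prod_(j in S) z_(m+j), in order. *)
Definition factors (a : 'X_{1..m}) (S : {set 'I_(n + n)}) : seq idx :=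
  flatten [seq nseq (a i) (lshift (n + n) i) | i <- enum 'I_m]
  ++ [seq rshift m j | j <- enum S].

(* p(T): every z_k in p is replaced by the operator T k, the product of
   operators being composition, so that the leftmost factor acts last. *)
Definition subst_op (T : idx -> P -> P) (p q : P) : P :=
  \sum_(S : {set 'I_(n + n)}) \sum_(a <- msupp (p S))
    (p S)@_a *: foldr T q (factors a S).

Lemma z_pow (i : 'I_m) (k : nat) (p : P) (S : {set 'I_(n + n)}) :
  (\prod_(l <- nseq k (lshift (n + n) i)) z l * p) S = 'X_i ^+ k * p S.
Proof.
elim: k => [|k IHk] /=; first by rewrite big_nil !mul1r.
by rewrite big_cons -mulrA z_even IHk exprS mulrA.
Qed.

Lemma prod_z_odd (s : seq 'I_(n + n)) (S : {set 'I_(n + n)}) :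
  sorted (fun i j : 'I_(n + n) => i < j)%N s ->
  (\prod_(j <- s) z (rshift m j)) S = (S == [set j in s])%:R.
Proof.
elim: s S => [|j s IHs] S; first by rewrite big_nil ffunE set_nil.
move=> /= sS; have ss := path_sorted sS.
have jlt : all (fun i : 'I_(n + n) => (j < i)%N) s.
  by apply: order_path_min sS => a b c; apply: ltn_trans.
have js : j \notin s by apply/negP => /(allP jlt); rewrite ltnn.
rewrite big_cons z_odd IHs // set_cons.
case: ifPn => jS; last by case: eqP jS => // ->; rewrite setU11.
have -> : (S :\ j == [set j in s]) = (S == j |: [set j in s]).
  apply/eqP/eqP => [<-|->].
    by rewrite setD1K.
  by rewrite setU1K // inE.
case: eqP => [->|_]; last by rewrite mulr0.
rewrite setU1K ?inE // mulr1 /crossings big_set1 big1 ?expr0 // => i.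
by rewrite inE => /(allP jlt) ji; rewrite ltnNge ltnW.
Qed.

Lemma prod_factors (a : 'X_{1..m}) (S T : {set 'I_(n + n)}) :
  (\prod_(k <- factors a S) z k) T = if T == S then 'X_[a] else 0.
Proof.
have even_part (e : seq 'I_m) (p : P) :
    (\prod_(i <- e) \prod_(l <- nseq (a i) (lshift (n + n) i)) z l * p) T
    = \prod_(i <- e) 'X_i ^+ a i * p T.
  elim: e => [|i e IHe]; first by rewrite !big_nil !mul1r.
  by rewrite !big_cons -!mulrA z_pow IHe.
rewrite /factors big_cat big_flatten big_map even_part big_enum /= -mpolyXE_id.
rewrite big_map prod_z_odd.
  by rewrite set_enum; case: eqP; rewrite ?mulr1 ?mulr0.
apply: sorted_filter.
  by move=> x y w; apply: ltn_trans.
by have := iota_ltn_sorted 0 (n + n); rewrite -val_enum_ord sorted_map enumT.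
Qed.

(* subst_op replaces the factors of p in the order in which they occur here. *)
Lemma sp_expand (p : P) :
  p = \sum_(S : {set 'I_(n + n)}) \sum_(a <- msupp (p S))
        (p S)@_a *: \prod_(k <- factors a S) z k.
Proof.
have evS (I : Type) (r : seq I) (F : I -> P) T :
    (\sum_(i <- r) F i) T = \sum_(i <- r) F i T.
  by elim/big_rec2: _ => [|i x y _ <-]; rewrite ?ffunE.
apply/ffunP => T; rewrite evS (bigD1 T) //= [X in _ + X]big1 => [|S TS].
  rewrite addr0 evS [LHS]mpolyE; apply: eq_bigr => a _.
  by rewrite sp_scaleE prod_factors eqxx.
rewrite evS; apply: big1 => a _.
by rewrite sp_scaleE prod_factors eq_sym (negPf TS) scaler0.
Qed.

Definition eval0 (p : P) : K := (p set0).@[fun=> 0].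

Definition beta : 'M[K]_(m + (n + n)) :=
  block_mx
    (\matrix_(i, j) if i == j then if val i == 0%N then -1 else 1 else 0) 0
    0 (block_mx 0 (- 1%:M) 1%:M 0).

Lemma beta_unit : beta \in unitmx.
Proof.
rewrite /beta; set D := \matrix_(i, j) _.
have DD : D *m D = 1%:M.
  apply/matrixP => i j; rewrite !mxE (bigD1 i) //= big1 => [|l li].
    rewrite !mxE eqxx addr0; case: (eqVneq i j) => _; last by rewrite mulr0.
    by case: ifP => _; rewrite ?mulrNN mulr1.
  by rewrite mxE eq_sym (negPf li) mul0r.
suff /mulmx1_unit[] : block_mx D 0 0 (block_mx 0 (- 1%:M) 1%:M 0)
    *m block_mx D 0 0 (block_mx 0 1%:M (- 1%:M) 0) = 1%:M :> 'M[K]_(m + (n + n)) by [].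
rewrite !mulmx_block !(mulmx0, mul0mx, addr0, add0r, mulNmx, mulmxN, mulmx1).
by rewrite opprK DD -!scalar_mx_block.
Qed.

(* The lower-index derivation \partial_j. *)
Definition dlow (j : idx) (p : P) : P := \sum_i beta j i *: dup i p.

Definition euler (p : P) : P :=
  \sum_i \sum_j invmx beta i j *: (z i * dlow j p).

Definition laplace (p : P) : P :=
  \sum_i \sum_j invmx beta i j *: dlow i (dlow j p).

Definition superdim : K := m%:R - (2 * n)%N%:R.

Definition bessel (k : idx) (p : P) : P :=
  (superdim - 2) *: dlow k p + 2 *: euler (dlow k p) - z k * laplace p.

Definition mod_bessel (k : idx) (p : P) : P :=
  if val k == 0%N then - bessel k p else bessel k p.

End SuperPolynomials.

Definition sp_conj (C : numClosedFieldType) (m n : nat)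
    (p : superpoly C m n) : superpoly C m n :=
  [ffun S : {set 'I_(n + n)} => map_mpoly (@Num.conj C) (p S)].

Definition bessel_fischer (C : numClosedFieldType) (m n : nat)
    (p q : superpoly C m n) : C :=
  eval0 (subst_op (@mod_bessel C m n) p (sp_conj q)).

(* Main.v *)
(* Dropping the complex conjugation, the claim is that the bilinear form
   (p, q) = p(B~) q (0) is supersymmetric. Since the B~_k supercommute,
   (z_k p, q) = +-(p, B~_k q) by construction, so it suffices to prove
   (p, z_k q) = +-(B~_k p, q), by induction on p. Both sides for z_l p are
   expanded with the supercommutator [B_k, z_l} = beta_kl (M - 2 + 2E) - 2 L_kl,
   where L_kl = z_k d_l -+ z_l d_k, and what remains is that E is self-adjoint and
   L_kl skew-adjoint up to signs. This holds because E and L_kl act on the B_j by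
   supercommutators as they do on the z_j (by the opposite scalar for E) and because
   E f and L_kl f vanish at 0. All signs are handled by the grading twist
   p |-> (-1)^(a |p|) p, so that these identities are linear in p. Operator
   identities are proved on 1 and then propagated along p |-> z_k p. *)

From HB Require Import structures.
Require Import Defs.
From mathcomp Require Import all_boot all_order all_algebra.
From mathcomp Require Import reals complex mpoly ring.

Set Implicit Arguments.
Unset Strict Implicit.
Unset Printing Implicit Defensive.

Import GRing.Theory Num.Theory.

Local Open Scope ring_scope.

(** * Koszul signs, induction on superpolynomials, and the supersymmetric matrix [beta] *)

Section Relations.

Variables (K : fieldType) (m n : nat).
Local Notation P := (superpoly K m n).
Local Notation idx := 'I_(m + (n + n)).
Implicit Types (p q : P) (i j k l : idx) (a b : bool).
Local Notation beta := (@Defs.beta K m n).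

(** The Koszul sign for exchanging elements of parities [a] and [b], taken in [K] so that it can act
    as a scalar on superpolynomials. *)
Definition ksign a b : K := (-1) ^+ (a * b)%N.
Local Notation s i j := (ksign (parity i) (parity j)).

Lemma ksignC a b : ksign a b = ksign b a.
Proof. by rewrite /ksign mulnC. Qed.

Lemma ksign_addl a b b' : ksign (a (+) b) b' = ksign a b' * ksign b b'.
Proof.
by case: a b b' => [] [] []; rewrite /ksign /= ?expr1 ?expr0 ?mulrNN ?mulr1 ?mul1r.
Qed.

Lemma ksign_sqr a b : ksign a b * ksign a b = 1.
Proof. by rewrite -expr2 sqrr_sign. Qed.

Lemma coordP p q :
  (forall (S : {set 'I_(n + n)}) (u : 'X_{1..m}), (p S)@_u = (q S)@_u) -> p = q.
Proof. by move=> h; apply/ffunP => S; apply/mpolyP => u. Qed.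

(** Coefficient extraction is linear and separates points. The values of [f] appear as variables
    [u], [v] so that unification can build the image of a compound term from its subterms. *)
Lemma functionalP p q :
  (forall f : P -> K,
     (forall x y u v, f x = u -> f y = v -> f (x + y) = u + v) ->
     (forall (a : K) x u, f x = u -> f (a *: x) = a * u) ->
     (forall x u, f x = u -> f (- x) = - u) -> f p = f q) -> p = q.
Proof.
move=> h; apply: coordP => S u.
apply: (h (fun x : P => (x S)@_u)) => [x y _ _ <- <-|a x _ <-|x _ <-].
- by rewrite sp_addE mcoeffD.
- by rewrite sp_scaleE mcoeffZ.
- by rewrite -scaleN1r sp_scaleE mcoeffZ mulN1r.
Qed.

(** This serves identities that hold only modulo relations between scalars: [e] collects the defect,
    with coefficients that vanish by these relations, and [x - y = e] is then purely formal. *)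
Lemma eq_of_subr0 (V : zmodType) (x y e : V) : e = 0 -> x - y = e -> x = y.
Proof. by move=> -> /eqP; rewrite subr_eq0 => /eqP. Qed.

Lemma superpoly_ind (Q : P -> Prop) :
  (forall p q, Q p -> Q q -> Q (p + q)) -> (forall (x : K) p, Q p -> Q (x *: p)) ->
  Q 1 -> (forall k p, Q p -> Q (z K k * p)) -> forall p, Q p.
Proof.
move=> QD QZ Q1 Qz p; have Q0 : Q 0 by rewrite -(scale0r (1 : P)); apply: QZ.
rewrite (sp_expand p); apply: big_ind => // S _; apply: big_ind => // u _; apply: QZ.
by elim: (factors u S) => [|k w IH]; rewrite ?big_nil // big_cons; apply: Qz.
Qed.

Lemma z_swap i j p : z K i * (z K j * p) = s i j *: (z K j * (z K i * p)).
Proof.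
rewrite mulrA z_supercomm -2!mulrA /ksign.
move: (_ * _)%N (z K j * (z K i * _)) => N x.
rewrite -signr_odd -[in RHS]signr_odd.
by case: odd; rewrite ?expr0 ?expr1 ?mul1r ?mulN1r ?scale1r ?scaleN1r.
Qed.

(** The Leibniz rule on 1 * 1 makes the derivative of 1 equal to twice itself. *)
Lemma dup1 k : dup k (1 : P) = 0.
Proof.
have h : homogeneous false (1 : P).
  apply/homogeneousP => S; rewrite ffunE.
  by case: (eqVneq S set0) => [->|_]; rewrite ?cards0 ?eqxx.
have := dup_superder k 1 h; rewrite !mulr1 mul1r muln0 expr0 scale1r.
by move=> /(congr1 (fun x => x - dup k 1)); rewrite addrK subrr.
Qed.

Lemma dup_zM i k p : dup i (z K k * p) = (i == k)%:R *: p + s i k *: (z K k * dup i p).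
Proof.
rewrite (dup_superder _ _ (z_homogeneous K k)) dup_z; congr (_ + _).
by case: eqP; rewrite ?mul1r ?mul0r ?scale1r ?scale0r.
Qed.

Lemma beta_ll (i j : 'I_m) : beta (lshift (n + n) i) (lshift (n + n) j) =
  if i == j then if val i == 0%N then -1 else 1 else 0.
Proof. by rewrite /Defs.beta block_mxEul mxE. Qed.

Lemma beta_lr (i : 'I_m) (j : 'I_(n + n)) : beta (lshift (n + n) i) (rshift m j) = 0.
Proof. by rewrite /Defs.beta block_mxEur mxE. Qed.

Lemma beta_rl (i : 'I_m) (j : 'I_(n + n)) : beta (rshift m j) (lshift (n + n) i) = 0.
Proof. by rewrite /Defs.beta block_mxEdl mxE. Qed.

Lemma beta_rr_skew (i j : 'I_(n + n)) :
  beta (rshift m j) (rshift m i) = - beta (rshift m i) (rshift m j).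
Proof.
rewrite /Defs.beta !block_mxEdr.
case: (split_ordP i) => k ->; case: (split_ordP j) => l ->;
  rewrite ?block_mxEul ?block_mxEur ?block_mxEdl ?block_mxEdr !mxE ?oppr0 ?opprK //.
  by rewrite eq_sym.
by rewrite eq_sym.
Qed.

Lemma beta_parity i j : parity i != parity j -> beta i j = 0.
Proof.
case: (split_ordP i) => k ->; case: (split_ordP j) => l ->;
  by rewrite ?parity_lshift ?parity_rshift ?beta_lr ?beta_rl.
Qed.

Lemma beta_sym i j : beta j i = s i j * beta i j.
Proof.
case: (split_ordP i) => k ->; case: (split_ordP j) => l ->;
  rewrite ?parity_lshift ?parity_rshift ?beta_lr ?beta_rl ?mulr0 //.
  rewrite !beta_ll /ksign expr0 mul1r eq_sym.
  by case: eqVneq => [->|].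
by rewrite /ksign expr1 mulN1r beta_rr_skew.
Qed.

(** The even block is diagonal, so index 0 is paired only with itself; [0 < m] guarantees that index
    0 is even. *)
Lemma beta_index0 i j : (val i == 0%N) != (val j == 0%N) -> (0 < m)%N -> beta i j = 0.
Proof.
move=> nij m0; case: (split_ordP i) nij => k ->; case: (split_ordP j) => l ->;
  rewrite ?beta_lr ?beta_rl ?beta_ll //.
  by case: (eqVneq k l) => // ->; rewrite eqxx.
by rewrite /= !addn_eq0 (gtn_eqF m0).
Qed.

(** [beta] is orthogonal: the even block is diagonal with entries 1 and -1, and the standard
    symplectic block is orthogonal as well. *)
Lemma invmx_beta : invmx beta = beta^T.
Proof.
suff h : beta *m beta^T = 1%:M.
  by rewrite -[RHS](mulKmx (@beta_unit K m n)) h mulmx1.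
rewrite /Defs.beta !tr_block_mx !mulmx_block !linear0 linearN /= trmx1.
rewrite !(mulmx0, mul0mx, addr0, add0r, mulNmx, mulmxN, mulmx1, opprK).
set D := \matrix_(i, j) _.
suff -> : D *m D^T = 1%:M by rewrite -!scalar_mx_block.
apply/matrixP => i j; rewrite !mxE (bigD1 i) //= big1 => [|l li].
  rewrite !mxE eqxx addr0 [j == i]eq_sym; case: (eqVneq i j) => [->|_]; last by rewrite mulr0.
  by case: ifP => _; rewrite ?mulrNN mulr1.
by rewrite mxE eq_sym (negPf li) mul0r.
Qed.

End Relations.

(* [module_ring] proves a linear identity in [superpoly] by applying an arbitrary
   linear functional and calling [ring]. The functional is pushed to the atoms
   syntactically and the atoms are then abstracted, because unification up to
   conversion in [superpoly] is prohibitively slow. *)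
Ltac abstract_coefs := repeat
  match goal with
  | |- context [fun_of_matrix ?M ?i ?j] => move: (fun_of_matrix M i j) => ?
  | |- context [ksign ?K ?a ?b] => move: (ksign K a b) => ?
  end.
Ltac push_functional fD fZ fN :=
  lazymatch goal with
  | |- ?f (?x + ?y) = _ =>
      refine (fD x y _ _ _ _); [push_functional fD fZ fN | push_functional fD fZ fN]
  | |- ?f (?a *: ?x) = _ => refine (fZ a x _ _); push_functional fD fZ fN
  | |- ?f (- ?x) = _ => refine (fN x _ _); push_functional fD fZ fN
  | |- _ => reflexivity
  end.
Ltac module_ring :=
  abstract_coefs; refine (functionalP _);
  let f := fresh "f" in let fD := fresh in let fZ := fresh in let fN := fresh in
  intros f fD fZ fN;
  refine (etrans _ (etrans _ (esym _)));
  [push_functional fD fZ fN | | push_functional fD fZ fN]; cbv beta;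
  clear fD fZ fN;
  repeat match goal with |- context [f ?x] => generalize (f x); intro end;
  ring.

(** * Commutation of the lower derivatives, the Euler operator and the Laplacian with multiplication
    by a generator *)

Section LowerIndices.

Variables (K : fieldType) (m n : nat).
Local Notation P := (superpoly K m n).
Local Notation idx := 'I_(m + (n + n)).
Implicit Types (p q : P) (i j k l : idx) (a b : bool).
Local Notation beta := (@Defs.beta K m n).
Local Notation s i j := (ksign K (parity i) (parity j)).

Lemma dlow_is_linear k : linear (@dlow K m n k).
Proof.
move=> x p q; rewrite /dlow scaler_sumr -big_split; apply: eq_bigr => i _ /=.
by rewrite linearP scalerDr !scalerA mulrC.
Qed.

HB.instance Definition _ k :=
  GRing.isLinear.Build K P P *:%R (@dlow K m n k) (dlow_is_linear k).

Lemma dlowD k : {morph @dlow K m n k : p q / p + q}.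
Proof. exact: linearD. Qed.

Lemma dlowZ k x p : dlow k (x *: p) = x *: dlow k p.
Proof. exact: linearZ. Qed.

Lemma euler_is_linear : linear (@euler K m n).
Proof.
move=> x p q; rewrite /euler scaler_sumr -big_split; apply: eq_bigr => i _ /=.
rewrite scaler_sumr -big_split; apply: eq_bigr => j _ /=.
by rewrite linearP mulrDr scalerDr -scalerAr !scalerA mulrC.
Qed.

HB.instance Definition _ :=
  GRing.isLinear.Build K P P *:%R (@euler K m n) euler_is_linear.

Lemma laplace_is_linear : linear (@laplace K m n).
Proof.
move=> x p q; rewrite /laplace scaler_sumr -big_split; apply: eq_bigr => i _ /=.
rewrite scaler_sumr -big_split; apply: eq_bigr => j _ /=.
by rewrite !(dlowD, dlowZ) scalerDr !scalerA mulrC.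
Qed.

HB.instance Definition _ :=
  GRing.isLinear.Build K P P *:%R (@laplace K m n) laplace_is_linear.

Lemma dlow1 k : dlow k (1 : P) = 0.
Proof. by rewrite /dlow big1 // => i _; rewrite dup1 scaler0. Qed.

Lemma euler1 : euler (1 : P) = 0.
Proof.
by rewrite /euler big1 // => i _; rewrite big1 // => j _; rewrite dlow1 mulr0 scaler0.
Qed.

Lemma laplace1 : laplace (1 : P) = 0.
Proof.
by rewrite /laplace big1 // => i _; rewrite big1 // => j _; rewrite dlow1 linear0 scaler0.
Qed.

(** Applied from right to left, it turns a single term into a sum, so that two sides can be compared
    summand by summand. *)
Lemma sum_delta k (F : idx -> P) : \sum_i (i == k)%:R *: F i = F k.
Proof.
rewrite (bigD1 k) //= eqxx scale1r big1 ?addr0 // => i /negPf ->.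
by rewrite scale0r.
Qed.

Lemma dlow_zM j k p : dlow j (z K k * p) = beta j k *: p + s j k *: (z K k * dlow j p).
Proof.
rewrite /dlow mulr_sumr scaler_sumr -(sum_delta k (fun i => beta j i *: p)) -big_split.
apply: eq_bigr => i _ /=; rewrite dup_zM scalerDr -scalerAr !scalerA; congr (_ + _).
  by rewrite mulrC.
case: (eqVneq (parity i) (parity j)) => [->|ij]; first by rewrite mulrC.
by rewrite beta_parity ?mul0r ?mulr0 // eq_sym.
Qed.

(** Raising and lowering the index cancel, since the transpose of [beta] is its inverse; what
    remains does not involve the metric. *)
Lemma eulerE p : euler p = \sum_i z K i * dup i p.
Proof.
rewrite /euler; apply: eq_bigr => i _; rewrite invmx_beta.
under eq_bigr => j _ do rewrite scalerAr.
rewrite -mulr_sumr; congr (_ * _).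
under eq_bigr => j _ do rewrite /dlow scaler_sumr.
rewrite exchange_big /= -(sum_delta i (fun k => dup k p)).
apply: eq_bigr => k _; under eq_bigr => j _ do rewrite scalerA.
rewrite -scaler_suml; congr (_ *: _).
have /matrixP/(_ i k) : beta^T *m beta = 1%:M by rewrite -invmx_beta mulVmx ?beta_unit.
by rewrite !mxE eq_sym.
Qed.

Lemma euler_zM k p : euler (z K k * p) = z K k * p + z K k * euler p.
Proof.
rewrite !eulerE mulr_sumr -[X in _ = X + _](sum_delta k (fun i => z K i * p)).
rewrite -big_split.
apply: eq_bigr => i _ /=; rewrite dup_zM mulrDr -!scalerAr; congr (_ + _).
by rewrite (z_swap i) scalerA ksign_sqr scale1r.
Qed.

(** Passing [z_k] through two derivatives leaves one contraction for each, and both contractions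
    equal [dlow k p]. *)
Lemma laplace_zM k p :
  laplace (z K k * p) = z K k * laplace p + 2 *: dlow k p.
Proof.
have dk : dlow k p = \sum_i \sum_j (beta j i * beta j k) *: dlow i p.
  rewrite -(sum_delta k (fun i => dlow i p)); apply: eq_bigr => i _.
  rewrite -scaler_suml; congr (_ *: _).
  have /matrixP/(_ i k) : beta^T *m beta = 1%:M by rewrite -invmx_beta mulVmx ?beta_unit.
  by rewrite !mxE => <-; apply: eq_bigr => j _; rewrite mxE.
(* The second contraction agrees with the first after the summation indices are exchanged: the sign
   from passing [z_k] is absorbed by the supersymmetry of [beta]. *)
have dk' : dlow k p = \sum_i \sum_j (beta j i * s j k * beta i k) *: dlow j p.
  rewrite exchange_big dk; apply: eq_bigr => j _; apply: eq_bigr => i _ /=.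
  congr (_ *: _); rewrite (beta_sym K i j).
  case: (eqVneq (parity i) (parity k)) => [->|ik]; last by rewrite (beta_parity _ ik) !mulr0.
  by rewrite -[LHS]mul1r -(ksign_sqr K (parity k) (parity j)) [s j k]ksignC; ring.
rewrite scaler_nat mulr2n {1}dk dk' /laplace mulr_sumr -!big_split invmx_beta.
apply: eq_bigr => i _ /=; rewrite mulr_sumr -!big_split; apply: eq_bigr => j _ /=.
have e : beta j i * s j k * s i k = beta j i.
  case: (eqVneq (parity j) (parity i)) => [->|ij]; first by rewrite -mulrA ksign_sqr mulr1.
  by rewrite beta_parity ?mul0r.
rewrite mxE !(dlow_zM, dlowD, dlowZ) !scalerDr !scalerA e -scalerAr.
by rewrite [RHS]addrC addrA.
Qed.

End LowerIndices.

(* The operators are locked: otherwise matching, e.g., [laplace p] against a sum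
   unfolds its definition and does not terminate in practice. *)
Fact op_key : unit. Proof. exact: tt. Qed.

(** * Commutation relations among multiplications, derivatives, Euler operator and Laplacian *)

Section OperatorRelations.

Variables (K : fieldType) (m n : nat).
Local Notation P := (superpoly K m n).
Local Notation idx := 'I_(m + (n + n)).
Implicit Types (p q : P) (i j k l : idx) (a b : bool).
Local Notation beta := (@Defs.beta K m n).
Local Notation s i j := (ksign K (parity i) (parity j)).

Definition mulz k : P -> P := locked_with op_key (fun p => z K k * p).
Definition pd k : P -> P := locked_with op_key (@dlow K m n k).
Definition eul : P -> P := locked_with op_key (@euler K m n).
Definition lap : P -> P := locked_with op_key (@laplace K m n).

Lemma mulz_def k p : mulz k p = z K k * p.
Proof. by rewrite /mulz unlock. Qed.

Lemma pd_def k p : pd k p = dlow k p.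
Proof. by rewrite /pd unlock. Qed.

Lemma eul_def p : eul p = euler p.
Proof. by rewrite /eul unlock. Qed.

Lemma lap_def p : lap p = laplace p.
Proof. by rewrite /lap unlock. Qed.

Lemma mulz_is_linear k : linear (mulz k).
Proof. by move=> x p q; rewrite !mulz_def mulrDr scalerAr. Qed.

Lemma pd_is_linear k : linear (pd k).
Proof. by move=> x p q; rewrite !pd_def linearP. Qed.

Lemma eul_is_linear : linear eul.
Proof. by move=> x p q; rewrite !eul_def linearP. Qed.

Lemma lap_is_linear : linear lap.
Proof. by move=> x p q; rewrite !lap_def linearP. Qed.

HB.instance Definition _ k :=
  GRing.isLinear.Build K P P *:%R (mulz k) (mulz_is_linear k).

HB.instance Definition _ k :=
  GRing.isLinear.Build K P P *:%R (pd k) (pd_is_linear k).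

HB.instance Definition _ :=
  GRing.isLinear.Build K P P *:%R eul eul_is_linear.

HB.instance Definition _ :=
  GRing.isLinear.Build K P P *:%R lap lap_is_linear.

Lemma mulzD k p q : mulz k (p + q) = mulz k p + mulz k q.
Proof. exact: linearD. Qed.
Lemma mulzZ k x p : mulz k (x *: p) = x *: mulz k p.
Proof. exact: linearZ. Qed.
Lemma pdD k p q : pd k (p + q) = pd k p + pd k q.
Proof. exact: linearD. Qed.
Lemma pdZ k x p : pd k (x *: p) = x *: pd k p.
Proof. exact: linearZ. Qed.
Lemma eulD p q : eul (p + q) = eul p + eul q.
Proof. exact: linearD. Qed.
Lemma eulZ x p : eul (x *: p) = x *: eul p.
Proof. exact: linearZ. Qed.
Lemma lapD p q : lap (p + q) = lap p + lap q.
Proof. exact: linearD. Qed.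
Lemma lapZ x p : lap (x *: p) = x *: lap p.
Proof. exact: linearZ. Qed.

Definition opE := (mulzD, mulzZ, pdD, pdZ, eulD, eulZ, lapD, lapZ).

Lemma op1 : ((forall k, pd k 1 = 0) * (eul 1 = 0) * (lap 1 = 0))%type.
Proof.
by split; [split=> [k|]|]; rewrite ?pd_def ?eul_def ?lap_def ?dlow1 ?euler1 ?laplace1.
Qed.

Lemma op0 : ((forall k, pd k 0 = 0) * (eul 0 = 0) * (lap 0 = 0))%type.
Proof. by split; [split=> [k|]|]; rewrite ?pd_def ?eul_def ?lap_def linear0. Qed.

Lemma mulz_ind (Q : P -> Prop) :
  (forall p q, Q p -> Q q -> Q (p + q)) -> (forall (x : K) p, Q p -> Q (x *: p)) ->
  Q 1 -> (forall k p, Q p -> Q (mulz k p)) -> forall p, Q p.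
Proof.
move=> QD QZ Q1 Qz; apply: superpoly_ind => // k p; rewrite -mulz_def; exact: Qz.
Qed.

Lemma mulz_swap i j p : mulz i (mulz j p) = s i j *: mulz j (mulz i p).
Proof. by rewrite !mulz_def z_swap. Qed.

Lemma pd_mulz j k p : pd j (mulz k p) = beta j k *: p + s j k *: mulz k (pd j p).
Proof. by rewrite !pd_def !mulz_def dlow_zM. Qed.

Lemma eul_mulz k p : eul (mulz k p) = mulz k p + mulz k (eul p).
Proof. by rewrite !eul_def !mulz_def euler_zM. Qed.

Lemma lap_mulz k p : lap (mulz k p) = mulz k (lap p) + 2 *: pd k p.
Proof. by rewrite !lap_def !pd_def !mulz_def laplace_zM. Qed.

Lemma beta_ksign i j k : beta i j * s i k = beta i j * s j k.
Proof.
by have [->|ij] := eqVneq (parity i) (parity j); rewrite ?(beta_parity _ ij) ?mul0r.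
Qed.

Lemma pd_swap i j p : pd i (pd j p) = s i j *: pd j (pd i p).
Proof.
elim/mulz_ind: p => [p q hp hq|x p hp||k p hp].
- by rewrite !opE hp hq scalerDr.
- by rewrite !opE hp !scalerA mulrC.
- by rewrite !(op1, op0) scaler0.
rewrite !(pd_mulz, opE) hp !opE.
(* These two scalars vanish because [beta] pairs only indices of equal parity, a fact that [ring]
   cannot see. *)
have e1 : beta j k * (1 - s i j * s i k) = 0.
  have := beta_ksign j k i; rewrite mulrBr mulr1 mulrA ![s i _]ksignC => ->.
  by rewrite -mulrA ksign_sqr mulr1 subrr.
have e2 : beta i k * (s j k - s i j) = 0.
  by rewrite mulrBr [s j k]ksignC -beta_ksign subrr.
apply: (@eq_of_subr0 _ _ _ ((beta j k * (1 - s i j * s i k)) *: pd i p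
  + (beta i k * (s j k - s i j)) *: pd j p)).
  by rewrite e1 e2 !scale0r addr0.
by module_ring.
Qed.

Lemma pd_eul j p : pd j (eul p) = pd j p + eul (pd j p).
Proof.
elim/mulz_ind: p => [p q hp hq|x p hp||k p hp].
- by rewrite !opE hp hq; module_ring.
- by rewrite !opE hp scalerDr.
- by rewrite !(op1, op0) addr0.
rewrite !(eul_mulz, pd_mulz, opE) hp !opE.
by module_ring.
Qed.

Lemma lap_pd j p : lap (pd j p) = pd j (lap p).
Proof.
elim/mulz_ind: p => [p q hp hq|x p hp||k p hp].
- by rewrite !opE hp hq.
- by rewrite !opE hp.
- by rewrite !(op1, op0).
rewrite !(lap_mulz, pd_mulz, opE) hp (pd_swap j k).
by module_ring.
Qed.

Lemma lap_eul p : lap (eul p) = eul (lap p) + 2 *: lap p.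
Proof.
elim/mulz_ind: p => [p q hp hq|x p hp||k p hp].
- by rewrite !opE hp hq; module_ring.
- by rewrite !opE hp; module_ring.
- by rewrite !(op1, op0) scaler0 addr0.
rewrite !(eul_mulz, lap_mulz, opE) hp pd_eul !opE.
by module_ring.
Qed.

End OperatorRelations.

(** * The Bessel operators and their relations with the orthosymplectic generators *)

Section Bessel.

Variables (K : fieldType) (m n : nat).
Local Notation P := (superpoly K m n).
Local Notation idx := 'I_(m + (n + n)).
Implicit Types (p q : P) (i j k l : idx) (a b : bool).
Local Notation beta := (@Defs.beta K m n).
Local Notation s i j := (ksign K (parity i) (parity j)).
Local Notation c := (superdim K m n - 2).
Local Notation B := (@bessel K m n).

(* The generators of osp(m|2n), up to scalars. *)
Definition ang k l : P -> P :=
  locked_with op_key (fun p => mulz k (pd l p) - s k l *: mulz l (pd k p)).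

Lemma besselE k p : B k p = c *: pd k p + 2 *: eul (pd k p) + (-1) *: mulz k (lap p).
Proof. by rewrite pd_def eul_def lap_def mulz_def scaleN1r. Qed.

Lemma angE k l p : ang k l p = mulz k (pd l p) + (-1) *: (s k l *: mulz l (pd k p)).
Proof. by rewrite /ang unlock scaleN1r. Qed.

(** Splitting into the two values replaces the relation that the square of a sign is 1, which [ring]
    does not use by itself. *)
Lemma ksignP a b : ksign K a b = 1 \/ ksign K a b = -1.
Proof. by rewrite /ksign -signr_odd; case: odd; [right|left]. Qed.

Lemma bessel_is_linear k : linear (B k).
Proof. move=> x p q; rewrite !besselE !opE; generalize c; move=> y; module_ring. Qed.

HB.instance Definition _ k :=
  GRing.isLinear.Build K P P *:%R (B k) (bessel_is_linear k).

Lemma ang_is_linear k l : linear (ang k l).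
Proof. move=> x p q; rewrite !angE !opE; module_ring. Qed.

HB.instance Definition _ k l :=
  GRing.isLinear.Build K P P *:%R (ang k l) (ang_is_linear k l).

(** Rewriting with these rules produces a normal order: multiplications outermost, then [eul], then
    [pd], with [lap] applied first. *)
Definition normE := (pd_mulz, eul_mulz, lap_mulz, pd_eul, lap_eul, lap_pd, opE).

Lemma bessel_swap i j p : B i (B j p) = s i j *: B j (B i p).
Proof.
rewrite !besselE !normE (pd_swap i j p) (mulz_swap i j) !opE.
rewrite (ksignC K (parity j)) (beta_sym K i j).
move: c => x; case: (ksignP (parity i) (parity j)) => ->; module_ring.
Qed.

Lemma bessel_mulz k l p : B k (mulz l p) =
  s k l *: mulz l (B k p) + beta k l *: (c *: p + 2 *: eul p) - 2 *: ang k l p.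
Proof.
rewrite !besselE !angE !normE (mulz_swap k l).
move: c => x; module_ring.
Qed.

(** Each Bessel operator lowers the degree by one. *)
Lemma eul_bessel k p : eul (B k p) = B k (eul p) - B k p.
Proof. rewrite !besselE !normE; move: c => x; module_ring. Qed.

Lemma ang_mulz k l j p : ang k l (mulz j p) = (s k j * s l j) *: mulz j (ang k l p)
  + beta l j *: mulz k p - (s k l * beta k j) *: mulz l p.
Proof.
rewrite !angE !normE (mulz_swap k j) (mulz_swap l j).
case: (ksignP (parity k) (parity j)) => ->; case: (ksignP (parity l) (parity j)) => ->;
module_ring.
Qed.

Lemma ang_eul k l p : ang k l (eul p) = eul (ang k l p).
Proof. rewrite !angE !normE; module_ring. Qed.

(** Invariance of the Laplacian: the two second-order terms produced by [lap_mulz] cancel by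
    [pd_swap]. *)
Lemma ang_lap k l p : ang k l (lap p) = lap (ang k l p).
Proof.
rewrite !angE !normE (pd_swap k l).
case: (ksignP (parity k) (parity l)) => ->; module_ring.
Qed.

Lemma ang_pd k l j p : ang k l (pd j p) = (s k j * s l j) *: pd j (ang k l p)
  + beta l j *: pd k p - (s k l * beta k j) *: pd l p.
Proof.
rewrite !angE !normE (pd_swap l j) (pd_swap k j) !opE.
rewrite (beta_sym K k j) (beta_sym K l j).
rewrite (ksignC K (parity j) (parity k)) (ksignC K (parity j) (parity l)).
(* As in [pd_swap], the defect is supported where [beta] pairs indices of different parity, hence is
   zero. *)
have e1 : beta k j * (s k l - s l j) = 0.
  by rewrite mulrBr (ksignC K (parity l)) -beta_ksign subrr.
have e2 : beta l j * (s k j * s k l - 1) = 0.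
  rewrite mulrBr mulr1 [s k j * _]mulrC mulrA (ksignC K _ (parity l)) beta_ksign.
  by rewrite -mulrA (ksignC K (parity j)) ksign_sqr mulr1 subrr.
apply: (@eq_of_subr0 _ _ _ ((beta k j * (s k l - s l j)) *: pd l p
  + (beta l j * (s k j * s k l - 1)) *: pd k p)).
  by rewrite e1 e2 !scale0r addr0.
case: (ksignP (parity k) (parity j)) => ->; case: (ksignP (parity l) (parity j)) => ->;
  module_ring.
Qed.

Lemma angD k l p q : ang k l (p + q) = ang k l p + ang k l q.
Proof. exact: linearD. Qed.

Lemma angZ k l x p : ang k l (x *: p) = x *: ang k l p.
Proof. exact: linearZ. Qed.

(** [ang k l] commutes with [eul] and [lap], and transforms [mulz j] and [pd j] by the same rule;
    the Bessel operators inherit that rule. *)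
Lemma ang_bessel k l j p : ang k l (B j p) = (s k j * s l j) *: B j (ang k l p)
  + beta l j *: B k p - (s k l * beta k j) *: B l p.
Proof.
rewrite !besselE !(angD, angZ, ang_eul, ang_mulz, ang_pd, ang_lap) -!scaleN1r !opE.
move: c => x; module_ring.
Qed.

Lemma ang_skew k l p : ang l k p = - s k l *: ang k l p.
Proof.
rewrite !angE (ksignC K (parity l)).
case: (ksignP (parity k) (parity l)) => ->; module_ring.
Qed.

Lemma bessel1 k : B k 1 = 0.
Proof. by rewrite besselE !op1 !op0 !linear0 !addr0. Qed.

End Bessel.

(** * Substitution of supercommuting operators into a superpolynomial *)

Lemma sum_msupp (K : nzRingType) (m : nat) (V : lmodType K) (F : 'X_{1..m} -> V)
    (x : {mpoly K[m]}) (r : seq 'X_{1..m}) : uniq r -> {subset msupp x <= r} ->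
  \sum_(u <- msupp x) x@_u *: F u = \sum_(u <- r) x@_u *: F u.
Proof.
move=> ur sr; rewrite [RHS](bigID (mem (msupp x))) /= [X in _ = _ + X]big1 ?addr0; last first.
  by move=> u ux; rewrite memN_msupp_eq0 ?scale0r.
rewrite -[RHS]big_filter; apply: perm_big; apply: uniq_perm => [||u].
- exact: msupp_uniq.
- exact: filter_uniq.
by rewrite mem_filter /=; case: (boolP (u \in msupp x)) => // /sr ->.
Qed.

Section Substitution.

Variables (K : fieldType) (m n : nat).
Local Notation P := (superpoly K m n).
Local Notation idx := 'I_(m + (n + n)).
Local Notation s i j := (ksign K (parity i) (parity j)).
Variable T : idx -> P -> P.
Implicit Types (p q : P) (k : idx) (S : {set 'I_(n + n)}) (u : 'X_{1..m}).

(* p(T) q, as a linear function of p *)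
Definition act q p : P := subst_op T p q.

Lemma act_is_linear q : linear (act q).
Proof.
move=> c p p'; rewrite /act /subst_op scaler_sumr -big_split; apply: eq_bigr => S _ /=.
(* The three supports may differ because of cancellation, so all sums are extended to one list
   containing them; by [sum_msupp] only zero terms are added. *)
pose r := undup (msupp ((c *: p + p') S) ++ msupp (p S) ++ msupp (p' S)).
have ur : uniq r := undup_uniq _.
have sr x : (x \in r) =
    [|| x \in msupp ((c *: p + p') S), x \in msupp (p S) | x \in msupp (p' S)].
  by rewrite mem_undup !mem_cat.
rewrite !(sum_msupp _ ur); try by move=> x; rewrite sr => ->; rewrite ?orbT.
rewrite scaler_sumr -big_split; apply: eq_bigr => u _ /=.
by rewrite sp_addE sp_scaleE mcoeffD mcoeffZ scalerDl scalerA.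
Qed.

HB.instance Definition _ q :=
  GRing.isLinear.Build K P P *:%R (act q) (act_is_linear q).

Definition mono u S : P := \prod_(k <- factors u S) z K k.

Lemma monoE u S S' : mono u S S' = if S' == S then 'X_[u] else 0.
Proof. exact: prod_factors. Qed.

Lemma act_mono u S q : act q (mono u S) = foldr T q (factors u S).
Proof.
rewrite /act /subst_op (bigD1 S) //= [X in _ + X]big1 => [|S' /negPf nS].
  by rewrite monoE eqxx msuppX big_seq1 mcoeffX eqxx scale1r addr0.
by rewrite monoE nS msupp0 big_nil.
Qed.

Lemma act1 q : act q 1 = q.
Proof.
have -> : 1 = mono 0%MM set0.
  by apply/ffunP => S; rewrite monoE ffunE mpolyX0; case: eqP.
rewrite act_mono /factors enum_set0 cats0.
by elim: (enum _) => //= i e IH; rewrite mnm0E.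
Qed.

Hypothesis T_linear : forall k, linear (T k).
Hypothesis T_swap : forall (i j : idx) q, T i (T j q) = s i j *: T j (T i q).
Hypothesis T_sqr : forall (j : idx) q, parity j -> T j (T j q) = 0.

Lemma operZ k (c : K) q : T k (c *: q) = c *: T k q.
Proof.
have T0 : T k 0 = 0.
  have := T_linear k 1 0 0; rewrite !scale1r addr0.
  by move=> /(congr1 (fun x => x - T k 0)); rewrite addrK subrr.
by have := T_linear k c q 0; rewrite T0 !addr0.
Qed.

Lemma foldr_oper_linear w q q' (c : K) :
  foldr T (c *: q + q') w = c *: foldr T q w + foldr T q' w.
Proof. by elim: w => //= k w ->; rewrite T_linear. Qed.

Lemma foldr_oper0 w : foldr T 0 w = 0.
Proof. by have := foldr_oper_linear w 0 0 (-1); rewrite !scaleN1r !addNr. Qed.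

Lemma foldr_operZ w (c : K) q : foldr T (c *: q) w = c *: foldr T q w.
Proof. by rewrite -[c *: q]addr0 foldr_oper_linear foldr_oper0 addr0. Qed.

Lemma foldr_even k q w : parity k = false -> T k (foldr T q w) = foldr T (T k q) w.
Proof.
move=> pk; elim: w => //= l w <-; rewrite T_swap pk /ksign mul0n expr0 scale1r //.
Qed.

(** The operator moves inward past the other odd factors until it meets its own copy, where [T_sqr]
    applies. *)
Lemma foldr_odd_mem (j : 'I_(n + n)) q (w : seq 'I_(n + n)) : j \in w ->
  T (rshift m j) (foldr T q [seq rshift m j | j <- w]) = 0.
Proof.
elim: w => //= l w IH; rewrite inE; have [<- _|_ /= /IH e] := eqVneq j l.
  by rewrite T_sqr ?parity_rshift.
by rewrite T_swap e -(scale0r q) operZ !scale0r ?scaler0.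
Qed.

(** The operator passes exactly the factors of [S] with smaller index, each contributing a sign.
    Both subsets are filters of one increasing list, along which the induction runs. *)
Lemma foldr_odd_notin (j : 'I_(n + n)) q (w : seq 'I_(n + n)) S :
  sorted (fun i j : 'I_(n + n) => i < j)%N w -> j \in w -> j \notin S ->
  T (rshift m j) (foldr T q [seq rshift m i | i <- [seq i <- w | i \in S]]) =
  (-1) ^+ (\sum_(i <- w | i \in S) (i < j))%N *:
    foldr T q [seq rshift m i | i <- [seq i <- w | i \in j |: S]].
Proof.
move=> + + jS; elim: w => //= l w IH sw; have ss := path_sorted sw.
have lw : all (fun i : 'I_(n + n) => (l < i)%N) w.
  by apply: order_path_min sw => a b c; apply: ltn_trans.
rewrite inE !inE big_cons; have [ejl _|jl /= jw] := eqVneq j l.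
  rewrite -ejl (negPf jS) ?eqxx /= big_seq_cond big1 ?expr0 ?scale1r; last first.
    by move=> i /andP[/(allP lw)]; rewrite -ejl => ji _; rewrite ltnNge ltnW.
  congr (T _ (foldr T q (map _ _))); apply: eq_in_filter => i iw; rewrite !inE.
  by move/(allP lw): iw; rewrite -ejl; case: eqP => // ->; rewrite ltnn.
rewrite ?(negPf jl) /=; case: ifP => lS; last exact: IH.
have lj : (l < j)%N by apply: (allP lw).
rewrite /= T_swap IH // operZ scalerA /ksign !parity_rshift lj expr1.
by rewrite exprS.
Qed.

Lemma factors_even (i : 'I_m) u S q :
  foldr T q (factors (U_(i) + u)%MM S) = T (lshift (n + n) i) (foldr T q (factors u S)).
Proof.
rewrite /factors !foldr_cat; move: (foldr T q _) => x.
have pi : parity (lshift (n + n) i) = false by exact: parity_lshift.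
(* The additional factor sits in the block of [i], so it is present only if that block has been
   listed in [e]. *)
have h (e : seq 'I_m) : uniq e ->
    foldr T x (flatten [seq nseq ((U_(i) + u)%MM j) (lshift (n + n) j) | j <- e])
    = foldr T (if i \in e then T (lshift (n + n) i) x else x)
        (flatten [seq nseq (u j) (lshift (n + n) j) | j <- e]).
  elim: e => //= j e IH /andP[je /IH {}IH]; rewrite !foldr_cat IH inE mnmDE mnm1E.
  have [ij|ij] := eqVneq i j; last by [].
  by rewrite -ij in je *; rewrite (negPf je) /= !foldr_even.
by rewrite h ?enum_uniq // mem_enum foldr_even.
Qed.

(** Substitution uses a fixed order of factors, so [T k] must be moved to its place; the signs this
    costs are those of reordering the generators themselves. *)
Lemma act_z k p q : act q (z K k * p) = T k (act q p).
Proof.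
have TD x y : T k (x + y) = T k x + T k y.
  by have := T_linear k 1 x y; rewrite !scale1r.
have T0 : T k 0 = 0 by rewrite -(scale0r q) operZ !scale0r.
rewrite (sp_expand p) mulr_sumr !raddf_sum /= (big_morph _ TD T0).
apply: eq_bigr => S _; rewrite mulr_sumr !raddf_sum (big_morph _ TD T0) /=.
apply: eq_bigr => u _; rewrite -scalerAr !linearZ /= operZ; congr (_ *: _).
rewrite -/(mono u S) act_mono; case: (split_ordP k) => i ->.
  have -> : z K (lshift (n + n) i) * mono u S = mono (U_(i) + u)%MM S.
    apply/ffunP => S'; rewrite z_even !monoE; case: eqP => _; last by rewrite mulr0.
    by rewrite mpolyXD.
  by rewrite act_mono factors_even.
have -> : z K (rshift m i) * mono u S =
    if i \in S then 0 else (-1) ^+ crossings [set i] S *: mono u (i |: S).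
  apply/ffunP => S'; rewrite z_odd; case: ifPn => iS'.
    rewrite monoE; case: (eqVneq (S' :\ i) S) => [eS|nS].
      rewrite -eS !inE eqxx /= sp_scaleE monoE setD1K // eqxx.
      by rewrite -mul_mpolyC rmorphXn rmorphN1.
    rewrite mulr0; case: ifP => iS; first by rewrite ffunE.
    rewrite sp_scaleE monoE; case: eqP => [eS'|_]; last by rewrite scaler0.
    by rewrite eS' setU1K ?iS ?eqxx // in nS.
  case: ifP => iS; first by rewrite ffunE.
  rewrite sp_scaleE monoE; case: eqP => [eS'|_]; last by rewrite scaler0.
  by rewrite eS' setU11 in iS'.
(* An odd operator crosses the block of even factors without a sign. *)
have TO x :
    T (rshift m i) (foldr T x (flatten [seq nseq (u j) (lshift (n + n) j) | j <- enum 'I_m]))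
    = foldr T (T (rshift m i) x)
        (flatten [seq nseq (u j) (lshift (n + n) j) | j <- enum 'I_m]).
  elim: (enum _) => //= j e; rewrite !foldr_cat => <-.
  move: (foldr T x _) => y; elim: (u j) => //= N <-.
  by rewrite T_swap parity_lshift /ksign muln0 expr0 scale1r.
rewrite /factors foldr_cat TO.
have sS : sorted (fun i j : 'I_(n + n) => i < j)%N (enum 'I_(n + n)).
  by have := iota_ltn_sorted 0 (n + n); rewrite -val_enum_ord sorted_map.
have eE (A : {set 'I_(n + n)}) : enum A = [seq j <- enum 'I_(n + n) | j \in A].
  by rewrite {1}/enum_mem -enumT.
case: ifPn => iS.
  by rewrite foldr_odd_mem ?mem_enum // foldr_oper0 linear0.
rewrite eE foldr_odd_notin ?mem_enum // linearZ /= act_mono /factors foldr_cat -eE.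
rewrite foldr_operZ; congr (_ ^+ _ *: _).
by rewrite /crossings big_set1 big_enum_cond /=.
Qed.

End Substitution.

(** * The grading twist and its commutation with the operators *)

Section Twist.

Variables (K : fieldType) (m n : nat).
Local Notation P := (superpoly K m n).
Local Notation idx := 'I_(m + (n + n)).
Implicit Types (p q : P) (i j k l : idx) (a b : bool).
Local Notation beta := (@Defs.beta K m n).
Local Notation s i j := (ksign K (parity i) (parity j)).

(* p |-> (-1)^(a |p|) p *)
Definition twist a p : P := [ffun S : {set 'I_(n + n)} => (-1) ^+ (a * #|S|)%N *: p S].

Lemma twist_is_linear a : linear (twist a).
Proof.
move=> c p q; apply/ffunP => S; rewrite !(sp_addE, sp_scaleE, ffunE) scalerDr.
by rewrite !scalerA mulrC.
Qed.

HB.instance Definition _ a :=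
  GRing.isLinear.Build K P P *:%R (twist a) (twist_is_linear a).

Lemma twistD a p q : twist a (p + q) = twist a p + twist a q.
Proof. exact: linearD. Qed.

Lemma twistZ a (c : K) p : twist a (c *: p) = c *: twist a p.
Proof. exact: linearZ. Qed.

Lemma twist_homogeneous a b p : homogeneous b p -> twist a p = ksign K a b *: p.
Proof.
move=> /homogeneousP hp; apply/ffunP => S; rewrite ffunE sp_scaleE.
have [->|/hp <-] := eqVneq (p S) 0; first by rewrite !scaler0.
by rewrite /ksign -signr_odd -[in RHS]signr_odd !oddM !oddb.
Qed.

Lemma twist1 a : twist a 1 = 1.
Proof.
apply/ffunP => S; rewrite !ffunE; case: (eqVneq S set0) => [->|_]; last by rewrite scaler0.
by rewrite cards0 muln0 scale1r.
Qed.

Lemma twist_twist a b p : twist a (twist b p) = twist (a (+) b) p.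
Proof.
apply/ffunP => S; rewrite !ffunE scalerA -exprD -mulnDl; congr (_ *: _).
by rewrite -signr_odd -[RHS]signr_odd !oddM !oddD !oddb.
Qed.

Lemma twist_mulz a k p : twist a (mulz k p) = ksign K a (parity k) *: mulz k (twist a p).
Proof.
rewrite !mulz_def; apply/ffunP => S; rewrite ffunE sp_scaleE.
case: (split_ordP k) => i ->.
  by rewrite !z_even ffunE parity_lshift /ksign muln0 expr0 scale1r scalerAr.
rewrite !z_odd parity_rshift; case: ifP => iS; last by rewrite !scaler0.
rewrite ffunE -scalerAr scalerA; congr (_ *: _).
by rewrite /ksign -exprD -mulnDr (cardsD1 i S) iS.
Qed.

Lemma twist_pd a k p : twist a (pd k p) = ksign K a (parity k) *: pd k (twist a p).
Proof.
elim/mulz_ind: p => [p q hp hq|x p hp||j p hp].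
- by rewrite !(opE, twistD) hp hq scalerDr.
- by rewrite !(opE, twistZ) hp !scalerA mulrC.
- by rewrite twist1 !op1 linear0 scaler0.
rewrite !(pd_mulz, twist_mulz, twistD, twistZ, opE) hp !opE.
(* The twist signs of the two indices cancel wherever [beta k j] is nonzero. *)
have e : beta k j * (1 - ksign K a (parity k) * ksign K a (parity j)) = 0.
  rewrite mulrBr mulr1 mulrA (ksignC K a (parity k)) (ksignC K a (parity j)).
  have [->|kj] := eqVneq (parity k) (parity j); last by rewrite beta_parity ?mul0r ?subrr.
  by rewrite -mulrA ksign_sqr mulr1 subrr.
apply: (@eq_of_subr0 _ _ _
  ((beta k j * (1 - ksign K a (parity k) * ksign K a (parity j))) *: twist a p)).
  by rewrite e scale0r.
by module_ring.
Qed.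

Lemma twist_eul a p : twist a (eul p) = eul (twist a p).
Proof.
elim/mulz_ind: p => [p q hp hq|x p hp||j p hp].
- by rewrite !(opE, twistD) hp hq.
- by rewrite !(opE, twistZ) hp.
- by rewrite twist1 !op1 linear0.
by rewrite !(eul_mulz, twist_mulz, twistD, opE) hp; module_ring.
Qed.

Lemma twist_lap a p : twist a (lap p) = lap (twist a p).
Proof.
elim/mulz_ind: p => [p q hp hq|x p hp||j p hp].
- by rewrite !(opE, twistD) hp hq.
- by rewrite !(opE, twistZ) hp.
- by rewrite twist1 !op1 linear0.
by rewrite !(lap_mulz, twist_mulz, twistD, twistZ, opE) hp twist_pd; module_ring.
Qed.

Lemma twist_bessel a k p :
  twist a (bessel k p) = ksign K a (parity k) *: bessel k (twist a p).
Proof.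
rewrite !besselE !(twistD, twistZ, twist_eul, twist_mulz, twist_pd, twist_lap) !opE.
by generalize (superdim K m n - 2) => x; module_ring.
Qed.

End Twist.

(** * The modified Bessel operators, obtained by a sign change at index 0 *)

Section ModifiedBessel.

Variables (K : fieldType) (m n : nat).
Local Notation P := (superpoly K m n).
Local Notation idx := 'I_(m + (n + n)).
Implicit Types (p q : P) (i j k l : idx) (a b : bool).
Local Notation beta := (@Defs.beta K m n).
Local Notation s i j := (ksign K (parity i) (parity j)).
Local Notation c := (superdim K m n - 2).

Definition mod_sign k : K := if val k == 0%N then -1 else 1.

Local Notation eps := mod_sign.

Definition mbes k : P -> P := locked_with op_key (@mod_bessel K m n k).

Lemma mbes_def k p : mbes k p = mod_bessel k p.
Proof. by rewrite /mbes unlock. Qed.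

Lemma mbesE k p : mbes k p = eps k *: bessel k p.
Proof.
by rewrite mbes_def /mod_bessel /mod_sign; case: ifP => _; rewrite ?scaleN1r ?scale1r.
Qed.

Lemma mod_sign_sqr k : eps k * eps k = 1.
Proof. by rewrite /mod_sign; case: ifP; rewrite ?mulrNN mulr1. Qed.

Lemma mbes_is_linear k : linear (mbes k).
Proof. by move=> x p q; rewrite !mbesE linearP scalerDr !scalerA mulrC. Qed.

HB.instance Definition _ k :=
  GRing.isLinear.Build K P P *:%R (mbes k) (mbes_is_linear k).

Lemma mbesD k p q : mbes k (p + q) = mbes k p + mbes k q.
Proof. exact: linearD. Qed.

Lemma mbesZ k (x : K) p : mbes k (x *: p) = x *: mbes k p.
Proof. exact: linearZ. Qed.

Lemma mbes1 k : mbes k 1 = 0.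
Proof. by rewrite mbesE bessel1 scaler0. Qed.

Lemma mbes_swap i j p : mbes i (mbes j p) = s i j *: mbes j (mbes i p).
Proof.
rewrite !mbesE ![bessel _ (eps _ *: _)]linearZ /= bessel_swap !scalerA.
by congr (_ *: _); ring.
Qed.

(** Exchanging the two equal odd factors shows that the square is its own negative, hence zero as 2
    is invertible. *)
Lemma mbes_sqr j p : (2 : K) != 0 -> parity j -> mbes j (mbes j p) = 0.
Proof.
move=> h2 pj; have := mbes_swap j j p; rewrite pj /ksign expr1 scaleN1r.
move=> /eqP; rewrite -addr_eq0 -mulr2n -scaler_nat scaler_eq0 (negPf h2).
by move/eqP.
Qed.

Lemma mbes_mulz k l p : mbes k (mulz l p) = s k l *: mulz l (mbes k p)
  + eps k *: (beta k l *: (c *: p + 2 *: eul p) - 2 *: ang k l p).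
Proof.
rewrite !mbesE bessel_mulz !opE; move: c (eps k) => x y; module_ring.
Qed.

Lemma eul_mbes k p : eul (mbes k p) = mbes k (eul p) - mbes k p.
Proof. by rewrite !mbesE opE eul_bessel scalerBr. Qed.

Lemma beta_mod_sign k l : (0 < m)%N -> beta k l * eps k = beta k l * eps l.
Proof.
move=> m0; rewrite /mod_sign; case: (eqVneq (val k == 0%N) (val l == 0%N)) => [->//|kl].
by rewrite beta_index0 ?mul0r.
Qed.

(** A nonzero [beta l j] forces equal signs at [l] and [j], and a nonzero [beta k j] equal signs at
    [k] and [j]; both correction terms therefore acquire the factor [eps k * eps l]. *)
Lemma ang_mbes k l j p : (0 < m)%N ->
  ang k l (mbes j p) = (s k j * s l j) *: mbes j (ang k l p)
  + (eps k * eps l) *: (beta l j *: mbes k p - (s k l * beta k j) *: mbes l p).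
Proof.
move=> m0; rewrite !mbesE angZ ang_bessel.
have e1 : beta k j * eps j = beta k j * eps k by rewrite beta_mod_sign.
have e2 : beta l j * eps j = beta l j * eps l by rewrite beta_mod_sign.
have ek := mod_sign_sqr k; have el := mod_sign_sqr l.
move: (bessel j _) (bessel k p) (bessel l p) => x y w.
apply: (@eq_of_subr0 _ _ _
 ((beta l j * eps j - beta l j * eps l * (eps k * eps k)) *: y
  - (s k l * (beta k j * eps j - beta k j * eps k * (eps l * eps l))) *: w)).
  by rewrite e1 e2 ek el !mulr1 !subrr mulr0 !scale0r subr0.
module_ring.
Qed.

Lemma twist_mbes a k p : twist a (mbes k p) = ksign K a (parity k) *: mbes k (twist a p).
Proof. by rewrite !mbesE twistZ twist_bessel !scalerA mulrC. Qed.

End ModifiedBessel.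

(** * Adjoints for the bilinear form, and its supersymmetry *)

Section Symmetry.

Variables (K : fieldType) (m n : nat).
Hypothesis char2 : (2 : K) != 0.
Hypothesis m_gt0 : (0 < m)%N.
Local Notation P := (superpoly K m n).
Local Notation idx := 'I_(m + (n + n)).
Implicit Types (p q : P) (i j k l : idx) (a b : bool).
Local Notation beta := (@Defs.beta K m n).
Local Notation s i j := (ksign K (parity i) (parity j)).
Local Notation c := (superdim K m n - 2).
Local Notation tw k := (twist (parity k)).
Local Notation eps := (@mod_sign K m n).

(* p(B~) q *)
Definition Phi q p : P := locked_with op_key (act (@mod_bessel K m n) q) p.

Lemma PhiE q p : Phi q p = subst_op (@mod_bessel K m n) p q.
Proof. by rewrite /Phi unlock. Qed.

Lemma Phi_is_linear q : linear (Phi q).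
Proof. by move=> x p p'; rewrite /Phi unlock linearP. Qed.

HB.instance Definition _ q :=
  GRing.isLinear.Build K P P *:%R (Phi q) (Phi_is_linear q).

Lemma PhiD q p p' : Phi q (p + p') = Phi q p + Phi q p'.
Proof. exact: linearD. Qed.

Lemma PhiZ q (x : K) p : Phi q (x *: p) = x *: Phi q p.
Proof. exact: linearZ. Qed.

Lemma PhiN q p : Phi q (- p) = - Phi q p.
Proof. exact: linearN. Qed.

Lemma Phi1 q : Phi q 1 = q.
Proof. by rewrite /Phi unlock act1. Qed.

Lemma Phi_mulz q k p : Phi q (mulz k p) = mbes k (Phi q p).
Proof.
rewrite mulz_def /Phi unlock mbes_def; apply: act_z => [l x y z|i j x|j x pj].
- by rewrite -!mbes_def linearP.
- by rewrite -!mbes_def mbes_swap.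
- by rewrite -!mbes_def mbes_sqr.
Qed.

Lemma Phi_linear_r p (x : K) q q' : Phi (x *: q + q') p = x *: Phi q p + Phi q' p.
Proof.
elim/mulz_ind: p => [p p' hp hp'|y p hp||k p hp].
- by rewrite !PhiD hp hp'; module_ring.
- by rewrite !PhiZ hp; module_ring.
- by rewrite !Phi1.
- by rewrite !Phi_mulz hp mbesD mbesZ.
Qed.

(** Moving the operator through all factors of p(B~) costs a sign depending on the parity of [p],
    which the twist records linearly. *)
Lemma mbes_Phi k q p : mbes k (Phi q p) = Phi (mbes k q) (tw k p).
Proof.
elim/mulz_ind: p => [p p' hp hp'|y p hp||l p hp].
- by rewrite twistD !PhiD mbesD hp hp'.
- by rewrite twistZ !PhiZ mbesZ hp.
- by rewrite twist1 !Phi1.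
- by rewrite twist_mulz PhiZ !Phi_mulz mbes_swap hp.
Qed.

(** Every factor of p(B~) lowers the degree by one, so the commutator of E with p(B~) is -(E
    p)(B~). *)
Lemma Phi_eul q p : Phi q (eul p) = Phi (eul q) p - eul (Phi q p).
Proof.
elim/mulz_ind: p => [p p' hp hp'|y p hp||l p hp].
- by rewrite !(PhiD, opE) hp hp'; module_ring.
- by rewrite !(PhiZ, opE) hp; module_ring.
- by rewrite op1 linear0 !Phi1 subrr.
- by rewrite eul_mulz PhiD !Phi_mulz hp eul_mbes linearB /=; module_ring.
Qed.

Lemma ang1 k l : ang k l (1 : P) = 0.
Proof. by rewrite angE !op1 !linear0 addr0. Qed.

(** The supercommutator of L_kl with p(B~) is, up to [eps k * eps l], the substitution of the
    operators into L_kl p. *)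
Lemma Phi_ang q k l p : (eps k * eps l) *: Phi q (ang k l p) =
  ang k l (Phi q p) - Phi (ang k l q) (tw k (tw l p)).
Proof.
elim/mulz_ind: p => [p p' hp hp'|y p hp||j p hp].
- rewrite angD PhiD scalerDr hp hp' PhiD angD !twistD PhiD; module_ring.
- rewrite !(PhiZ, angZ, twistZ) scalerA [_ * y]mulrC -scalerA hp; module_ring.
- by rewrite ang1 linear0 scaler0 !twist1 !Phi1 subrr.
rewrite !(ang_mulz, twist_mulz, twistZ, PhiD, PhiZ, PhiN, Phi_mulz) ang_mbes //.
(* This is the induction hypothesis solved for [ang k l (Phi q p)], with [mbes j] applied. *)
have -> : mbes j (ang k l (Phi q p)) = (eps k * eps l) *: mbes j (Phi q (ang k l p))
    + mbes j (Phi (ang k l q) (tw k (tw l p))).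
  by rewrite -mbesZ hp -mbesD subrK.
move: (eps k) (eps l) => x y; module_ring.
Qed.

Lemma eval0D p q : eval0 (p + q) = eval0 p + eval0 q.
Proof. by rewrite /eval0 sp_addE mevalD. Qed.

Lemma eval0Z (x : K) p : eval0 (x *: p) = x * eval0 p.
Proof. by rewrite /eval0 sp_scaleE mevalZ. Qed.

Lemma eval0_0 : eval0 (0 : P) = 0.
Proof. by rewrite -(scale0r (0 : P)) eval0Z mul0r. Qed.

Lemma eval0_mulz k p : eval0 (mulz k p) = 0.
Proof.
rewrite mulz_def /eval0; case: (split_ordP k) => i ->.
  by rewrite z_even mevalM mevalXU mul0r.
by rewrite z_odd inE meval0.
Qed.

Lemma eval0_eul p : eval0 (eul p) = 0.
Proof.
rewrite eul_def eulerE (big_morph _ eval0D eval0_0) big1 // => i _.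
by rewrite -mulz_def eval0_mulz.
Qed.

Lemma eval0_ang k l p : eval0 (ang k l p) = 0.
Proof. by rewrite angE eval0D !eval0Z !eval0_mulz !mulr0 addr0. Qed.

(* The Bessel-Fischer product without the complex conjugation of q. *)
Definition bil p q : K := eval0 (Phi q p).

Lemma bilDl p p' q : bil (p + p') q = bil p q + bil p' q.
Proof. by rewrite /bil PhiD eval0D. Qed.

Lemma bilZl (x : K) p q : bil (x *: p) q = x * bil p q.
Proof. by rewrite /bil PhiZ eval0Z. Qed.

Lemma bilDr p q q' : bil p (q + q') = bil p q + bil p q'.
Proof. by rewrite /bil -[q]scale1r Phi_linear_r eval0D scale1r eval0Z mul1r. Qed.

Lemma bil0r p : bil p 0 = 0.
Proof.
have := bilDr p 0 0; rewrite addr0.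
by move=> /(congr1 (fun x => x - bil p 0)); rewrite addrK subrr.
Qed.

Lemma bilZr (x : K) p q : bil p (x *: q) = x * bil p q.
Proof. by rewrite -[x *: q]addr0 /bil Phi_linear_r eval0D eval0Z -/(bil p 0) bil0r addr0. Qed.

Definition bilE := (bilDl, bilDr, bilZl, bilZr).

Lemma bil_mulzl k p q : bil (mulz k p) q = bil (tw k p) (mbes k q).
Proof. by rewrite /bil Phi_mulz mbes_Phi. Qed.

Lemma bil_eul p q : bil (eul p) q = bil p (eul q).
Proof. by rewrite /bil Phi_eul -scaleN1r eval0D eval0Z eval0_eul mulr0 addr0. Qed.

Lemma bil_ang k l p q :
  bil (ang k l p) q = - (eps k * eps l) * bil (tw k (tw l p)) (ang k l q).
Proof.
have /(congr1 (@eval0 K m n)) := Phi_ang q k l p.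
rewrite -scaleN1r eval0D !eval0Z eval0_ang add0r mulN1r -!/(bil _ _) => h.
rewrite mulNr -mulrN -h mulrA; have := mod_sign_sqr K k; have := mod_sign_sqr K l => el ek.
by rewrite mulrACA ek el !mul1r.
Qed.

Lemma mod_signP k : eps k = 1 \/ eps k = -1.
Proof. by rewrite /mod_sign; case: ifP; [right|left]. Qed.

(** The adjunction on the second argument, mirroring [bil_mulzl]. The free twist [b] keeps the
    statement stable under the twists created when factors cross the form. *)
Lemma bil_mulzr b k p q : bil (twist b p) (mulz k q) = bil (mbes k (tw k (twist b p))) q.
Proof.
elim/mulz_ind: p b k q => [p p' hp hp'|y p hp||l p hp] b k q.
- by rewrite !(twistD, mbesD, bilE) hp hp'.
- by rewrite !(twistZ, mbesZ, bilE) hp.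
- by rewrite !twist1 mbes1 /bil Phi1 eval0_mulz linear0 eval0_0.
rewrite twist_mulz !(twistZ, mbesZ, bilE); congr (_ * _).
(* On the left [z_l] crosses the form as [mbes l] and is commuted past [z_k]; on the right [mbes k]
   is commuted past [z_l]. The leading terms match by induction, the others by [bil_eul] and
   [bil_ang]. *)
rewrite bil_mulzl twist_mulz !(mbes_mulz, mbesZ, bilE) -!scaleN1r !(bilE, bil_mulzl).
rewrite !twist_twist hp bil_eul bil_ang !twist_twist.
rewrite twist_mbes !twist_twist bilZl (addbCA (parity l)) addbACA addbb addFb.
rewrite (ang_skew l k) bilZr (beta_sym K k l) (ksignC K (parity l)).
(* The scalar and Euler terms carry [beta k l], so either they vanish or the two indices share
   parity and sign. *)
have [->|[-> ekl]] : beta k l = 0 \/ parity k = parity l /\ eps k = eps l.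
  have [kl|kl] := eqVneq (parity k) (parity l); last by left; rewrite beta_parity.
  have [e|e] := eqVneq (val k == 0%N) (val l == 0%N); last by left; rewrite beta_index0.
  by right; rewrite /mod_sign e.
  move: c (bil _ _) (bil _ _) (bil _ _) (bil _ _) (bil _ _) (bil _ _) (eps l) => *.
  by case: (ksignP K (parity k) (parity l)) => ->; case: (mod_signP k) => ->; ring.
rewrite ekl; move: c (beta k l) (bil _ _) (bil _ _) (bil _ _) (bil _ _) => *.
by case: (ksignP K (parity l) (parity l)) => ->; case: (mod_signP l) => ->; ring.
Qed.

Lemma bil1r p : bil p 1 = eval0 p.
Proof.
elim/mulz_ind: p => [p p' hp hp'|y p hp||l p hp].
- by rewrite bilDl hp hp' eval0D.
- by rewrite bilZl hp eval0Z.
- by rewrite /bil Phi1.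
- by rewrite bil_mulzl mbes1 bil0r eval0_mulz.
Qed.

(** Induction on [q]: each generator in the right argument becomes a Bessel operator on [p] by
    [bil_mulzr], and returns to the left argument by [bil_mulzl]. *)
Lemma bil_sym a p q : homogeneous a p -> bil p q = bil (twist a q) p.
Proof.
(* Homogeneity is kept as an eigenvector condition for the twists, which passes to [mbes k p] by
   [twist_mbes] with the parity shifted by that of [k]. *)
move=> hp; have {hp} : forall b, twist b p = ksign K b a *: p.
  by move=> b; apply: twist_homogeneous.
elim/mulz_ind: q a p => [q q' hq hq'|y q hq||k q hq] a p hp.
- by rewrite twistD !bilE (hq a) ?(hq' a).
- by rewrite twistZ !bilE (hq a).
- by rewrite twist1 bil1r /bil Phi1.
have := bil_mulzr false k p q; rewrite hp /ksign mul0n expr0 scale1r => ->.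
rewrite hp mbesZ bilZl (hq (parity k (+) a)) => [|b]; last first.
  by rewrite twist_mbes hp mbesZ scalerA ksignC (ksignC K b a) -ksign_addl ksignC.
by rewrite twist_mulz bilZl bil_mulzl twist_twist ksignC.
Qed.

End Symmetry.

(** * Compatibility with complex conjugation and the superhermitian property *)

Section Conjugation.

Variables (C : numClosedFieldType) (m n : nat).
Local Notation P := (superpoly C m n).
Local Notation idx := 'I_(m + (n + n)).
Implicit Types (p q : P) (i j k l : idx) (a b : bool).
Local Notation c := (superdim C m n - 2).
Local Notation eps := (@mod_sign C m n).
Local Notation beta := (@Defs.beta C m n).

Lemma sp_conjD p q : sp_conj (p + q) = sp_conj p + sp_conj q.
Proof. by apply/ffunP => S; rewrite !ffunE rmorphD. Qed.

Lemma sp_conjZ (x : C) p : sp_conj (x *: p) = x^* *: sp_conj p.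
Proof. by apply/ffunP => S; rewrite !(sp_scaleE, ffunE) /= map_mpolyZ. Qed.

Lemma sp_conjK p : sp_conj (sp_conj p) = p.
Proof.
apply/ffunP => S; rewrite !ffunE; apply/mpolyP => u.
by rewrite !mcoeff_map_mpoly /= conjCK.
Qed.

Lemma sp_conj1 : sp_conj (1 : P) = 1.
Proof. by apply/ffunP => S; rewrite !ffunE rmorph_nat. Qed.

Lemma conj_mulz k p : sp_conj (mulz k p) = mulz k (sp_conj p).
Proof.
rewrite !mulz_def; apply/ffunP => S; rewrite ffunE; case: (split_ordP k) => i ->.
  by rewrite !z_even rmorphM /= map_mpolyX ffunE.
rewrite !z_odd; case: ifP => _; last by rewrite rmorph0.
by rewrite rmorphM /= rmorph_sign ffunE.
Qed.

Lemma beta_conj k l : (beta k l)^* = beta k l.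
Proof.
suff /CrealP : beta k l \is Num.real by [].
case: (split_ordP k) => i ->; case: (split_ordP l) => j ->;
  rewrite ?beta_lr ?beta_rl ?real0 // ?beta_ll.
  by case: ifP => _; [case: ifP => _|]; rewrite ?realN ?real1 ?real0.
rewrite /Defs.beta block_mxEdr.
case: (split_ordP i) => i' ->; case: (split_ordP j) => j' ->;
  rewrite ?block_mxEul ?block_mxEur ?block_mxEdl ?block_mxEdr !mxE ?realN;
  by rewrite ?real0 ?realn.
Qed.

Lemma conj_pd k p : sp_conj (pd k p) = pd k (sp_conj p).
Proof.
elim/mulz_ind: p => [p p' hp hp'|y p hp||l p hp].
- by rewrite pdD !sp_conjD pdD hp hp'.
- by rewrite pdZ !sp_conjZ pdZ hp.
- by rewrite sp_conj1 op1 -(scale0r 1) sp_conjZ conjC0 !scale0r.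
rewrite pd_mulz conj_mulz pd_mulz sp_conjD !sp_conjZ conj_mulz hp beta_conj /ksign.
by rewrite rmorph_sign.
Qed.

Lemma conj_eul p : sp_conj (eul p) = eul (sp_conj p).
Proof.
elim/mulz_ind: p => [p p' hp hp'|y p hp||l p hp].
- by rewrite eulD !sp_conjD eulD hp hp'.
- by rewrite eulZ !sp_conjZ eulZ hp.
- by rewrite sp_conj1 op1 -(scale0r 1) sp_conjZ conjC0 !scale0r.
by rewrite eul_mulz conj_mulz eul_mulz sp_conjD !conj_mulz hp.
Qed.

Lemma conj_lap p : sp_conj (lap p) = lap (sp_conj p).
Proof.
elim/mulz_ind: p => [p p' hp hp'|y p hp||l p hp].
- by rewrite lapD !sp_conjD lapD hp hp'.
- by rewrite lapZ !sp_conjZ lapZ hp.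
- by rewrite sp_conj1 op1 -(scale0r 1) sp_conjZ conjC0 !scale0r.
by rewrite lap_mulz conj_mulz lap_mulz sp_conjD sp_conjZ !conj_mulz conj_pd hp rmorph_nat.
Qed.

(** All scalars in the modified Bessel operators are real, and the constituent operators commute
    with conjugation. *)
Lemma conj_mbes k p : sp_conj (mbes k p) = mbes k (sp_conj p).
Proof.
rewrite !mbesE !besselE !(sp_conjD, sp_conjZ, conj_mulz, conj_pd, conj_eul, conj_lap).
have -> : (eps k)^* = eps k by rewrite /mod_sign; case: ifP; rewrite ?rmorphN ?rmorph1.
have -> : c^* = c by rewrite /superdim !rmorphB !rmorph_nat.
by rewrite rmorph_nat rmorphN1.
Qed.

Lemma eval0_conj p : eval0 (sp_conj p) = (eval0 p)^*.
Proof.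
rewrite /eval0 ffunE; move: (p set0) => x.
elim/mpolyind: x => [|y u x _ _ hx]; first by rewrite !raddf0.
rewrite rmorphD !mevalD hx [RHS]rmorphD /= map_mpolyZ !mevalZ rmorphM /=.
congr (_ * _ + _); rewrite map_mpolyX !mevalX rmorph_prod /=.
by apply: eq_bigr => i _; rewrite rmorphXn /= conjC0.
Qed.

Let two_neq0 : (2 : C) != 0.
Proof. by rewrite pnatr_eq0. Qed.

Lemma conj_bil p q : (bil p q)^* = bil (sp_conj p) (sp_conj q).
Proof.
rewrite /bil -eval0_conj; congr eval0.
elim/mulz_ind: p => [p p' hp hp'|y p hp||l p hp].
- by rewrite sp_conjD !PhiD sp_conjD hp hp'.
- by rewrite sp_conjZ !PhiZ sp_conjZ hp.
- by rewrite sp_conj1 !Phi1.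
by rewrite conj_mulz !(Phi_mulz two_neq0) conj_mbes hp.
Qed.

Lemma bessel_fischerE p q : bessel_fischer p q = bil p (sp_conj q).
Proof. by rewrite /bil PhiE. Qed.

Lemma homogeneous_conj a p : homogeneous a p -> homogeneous a (sp_conj p).
Proof.
move=> /homogeneousP hp; apply/homogeneousP => S; rewrite ffunE => nz; apply: hp.
by apply: contraNneq nz => ->; rewrite raddf0.
Qed.

Lemma bessel_fischer_superhermitian a b p q : (0 < m)%N ->
  homogeneous a p -> homogeneous b q ->
  bessel_fischer p q = (-1) ^+ (a * b)%N * (bessel_fischer q p)^*.
Proof.
move=> m0 hp hq.
(* The two conjugations of [p] cancel, and [bil_sym] leaves a twist on the conjugate of [q], whose
   parity yields the sign. *)
rewrite !bessel_fischerE conj_bil sp_conjK (bil_sym two_neq0 m0 _ hp).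
by rewrite (twist_homogeneous _ (homogeneous_conj hq)) bilZl.
Qed.

End Conjugation.

Theorem proposition4p7 (R : realType) (m n : nat) (hm : (2 <= m)%N)
    (a b : bool) (p q : superpoly R[i] m n)
    (hp : homogeneous a p) (hq : homogeneous b q) :
  bessel_fischer p q =
    (-1) ^+ (a * b)%N * (bessel_fischer q p)^*.
Proof. by apply: bessel_fischer_superhermitian hp hq; apply: ltnW. Qed.
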